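(* Let $w\in\widetilde{S_n}$ and let $(P,Q,\rho)$ be its image under AMBC, with $P,Q$ of shape $\lambda$. Then \[\operatorname{sgn}(w)\cdot(-1)^{\sum_{i=1}^n (w(i)-i)}=(-1)^{\operatorname{inv}(P)+\operatorname{inv}(Q)+\operatorname{inv}(\lambda)+\operatorname{inv}_\lambda(\rho)}.\]
   Context: Fix $n\ge1$. For $i\in\mathbb Z$ write $\overline{i}=i+n\mathbb Z$, $[\overline n]=\{\overline 1,\dots,\overline n\}$. $\widetilde{S_n}$ is the set of bijections $w:\mathbb Z\to\mathbb Z$ with $w(i+n)=w(i)+n$; more generally a partial permutation is an injection $w:U\to\mathbb Z$ with $U\subseteq\mathbb Z$ stable under $x\mapsto x\pm n$ and $w(i+n)=w(i)+n$. The balls of $w$ are the points $(i,w(i))$ (first coordinate = row, increasing southward; second = column, increasing eastward). A cell $(i,j)$ is northwest of $(i',j')$ if $i\le i'$, $j\le j'$ (strictly if both strict), northeast if $i\le i'$, $j\ge j'$, southwest if $i\ge i'$, $j\le j'$. Translates: images under $(i,j)\mapsto(i+kn,j+kn)$. AMBC. For a nonempty partial permutation $w$: a channel is a set of balls, invariant under translation by $(n,n)$, totally ordered by the northwest order, with maximal number of translation classes among such sets. There is a unique southwest-most channel $C$ (for every channel $C'$, each ball of $C$ is weakly southwest of some ball of $C'$). Number $C$ by consecutive integers $\tilde d$ increasing from northwest to southeast; for each ball $b$ set $d(b)=\max(\tilde d(b_k)+k)$ over sequences of balls $b=b_0,\dots,b_k$ with $b_{t+1}$ strictly northwest of $b_t$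 and $b_k\in C$ (finite). For each $t$, write the balls with $d=t$ as $(i_1,j_1),\dots,(i_s,j_s)$, $i_1<\dots<i_s$ (so $j_1>\dots>j_s$); outer corners are $(i_{r+1},j_r)$, $1\le r<s$; back corner is $(i_1,j_s)$. $\mathrm{fw}(w)$ is the partial permutation whose balls are all outer corners; $S$ is the set of back corners. Record the residues mod $n$ of the column indices of $S$ as the next row of $P$, of the row indices as the next row of $Q$, and $\sum_c(\lceil c_2/n\rceil-\lceil c_1/n\rceil)$ (one representative $c=(c_1,c_2)$ per translation class of $S$) as the next entry of $\rho$; then replace $w$ by $\mathrm{fw}(w)$ and repeat until empty. For $w\in\widetilde{S_n}$, $P,Q$ are tabloids of a common shape $\lambda$, a partition of $n$ ($\lambda_r$ = number of translation classes of back corners at step $r$), each containing every element of $[\overline n]$ once; a tabloid is a sequence of disjoint subsets (rows) of $[\overline n]$, row 1 highest. $\rho\in\mathbb Z^{\ell(\lambda)}$. Sign: the length $\ell(w)$ is the number of translation classes (under simultaneous translation by $(n,n)$) of pairs $(a,b)$ of balls of $w$ with $a$ strictly northeast of $b$; $\operatorname{sgn}(w)=(-1)^{\ell(w)}$. Broken order: the linear order $\overline1<\overline2<\dots<\overline n$ on $[\overline n]$. For a tabloid $T$, $\operatorname{inv}(T)$ is the number of pairs $\overline i<\overline j$ (broken order) such that $\overline i$ is in a strictly lower row of $T$ than $\overline j$. For a partition $\lambda$, $\operatorname{inv}(\lambda)=\lambda_2+\lambda_4+\lambda_6+\cdots$. For $\rho\in\mathbb Z^{\ell(\lambda)}$,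 $\operatorname{inv}_\lambda(\rho)=\sum_{i:\ \lambda_i \text{ odd}}\rho_i$. *)

(* Defs.v *)
From mathcomp Require Import all_boot all_order all_algebra.
Set Implicit Arguments. Unset Strict Implicit. Unset Printing Implicit Defensive.
Import Order.TTheory GRing.Theory Num.Theory.
Local Open Scope ring_scope.

(* A cell (row, column); rows increase southward, columns eastward. *)
Definition cell := (int * int)%type.
Definition cellset := cell -> Prop.

Definition ncard (T : eqType) (X : T -> Prop) (k : nat) : Prop :=
  exists s : seq T, [/\ uniq s, (forall x, x \in s <-> X x) & size s = k].

Definition trinv (n : nat) (X : cellset) : Prop :=
  forall x : cell, X x <-> X (x.1 + n%:Z, x.2 + n%:Z).

(* number of translation classes of a translation-invariant set of cells:
   each class has exactly one representative with row in [1, n]. *)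
Definition ncl (n : nat) (X : cellset) (k : nat) : Prop :=
  ncard (fun x : cell => X x /\ (1 <= x.1 <= n%:Z)) k.

Definition nw (a b : cell) : Prop := a.1 <= b.1 /\ a.2 <= b.2.
Definition snwb (a b : cell) : bool := (a.1 < b.1) && (a.2 < b.2).
Definition wsw (a b : cell) : Prop := b.1 <= a.1 /\ a.2 <= b.2.
Definition sne (a b : cell) : Prop := a.1 < b.1 /\ b.2 < a.2.

Definition chainset (n : nat) (B X : cellset) : Prop :=
  [/\ (forall x, X x -> B x), trinv n X &
      (forall a b, X a -> X b -> nw a b \/ nw b a)].

Definition channel (n : nat) (B X : cellset) : Prop :=
  chainset n B X /\
  exists k, ncl n X k /\
    (forall (Y : cellset) (k' : nat), chainset n B Y -> ncl n Y k' -> (k' <= k)%N).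

Definition swmost (n : nat) (B C : cellset) : Prop :=
  forall C', channel n B C' -> forall b, C b -> exists b', C' b' /\ wsw b b'.

(* numbering of C by consecutive integers increasing from NW to SE:
   a strictly order-preserving surjection onto Z *)
Definition numbering (C : cellset) (dt : cell -> int) : Prop :=
  (forall a b, C a -> C b -> a <> b -> nw a b -> dt a < dt b) /\
  (forall t : int, exists c, C c /\ dt c = t).

Definition dpath (B C : cellset) (b : cell) (s : seq cell) : Prop :=
  [/\ (forall x, x \in s -> B x), path (fun x y => snwb y x) b s & C (last b s)].

Definition dval (B C : cellset) (dt : cell -> int) (b : cell) (t : int) : Prop :=
  (exists s, dpath B C b s /\ dt (last b s) + (size s)%:Z = t) /\
  (forall s, dpath B C b s -> dt (last b s) + (size s)%:Z <= t).

Definition level (B C : cellset) (dt : cell -> int) (t : int) : cellset :=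
  fun x => B x /\ dval B C dt x t.

Definition outer_corner (L : cellset) (x : cell) : Prop :=
  exists a b, [/\ L a, L b, a.1 < b.1,
    (forall c, L c -> ~ (a.1 < c.1 /\ c.1 < b.1)) & x = (b.1, a.2)].

Definition back_corner (L : cellset) (x : cell) : Prop :=
  exists a b, [/\ L a, L b, (forall c, L c -> a.1 <= c.1),
    (forall c, L c -> c.1 <= b.1) & x = (a.1, b.2)].

Definition ambc_step (n : nat) (B B' S : cellset) : Prop :=
  exists (C : cellset) (dt : cell -> int),
    [/\ channel n B C, swmost n B C, numbering C dt,
        (forall x, B' x <-> exists t, outer_corner (level B C dt t) x) &
        (forall x, S x <-> exists t, back_corner (level B C dt t) x)].

Definition resid (n : nat) (c : int) : nat := absz (((c - 1) %% n%:Z)%Z + 1).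

Definition ceilz (n : nat) (c : int) : int := - ((- c) %/ n%:Z)%Z.

(* a row of a tabloid is a duplicate-free list of elements of {1..n} *)
Definition tabrow := seq nat.
Definition tabloid := seq tabrow.

Definition rec_rows (n : nat) (S : cellset) (p q : tabrow) : Prop :=
  [/\ uniq p, uniq q,
      (forall r : nat, r \in p <-> exists c, S c /\ resid n c.2 = r) &
      (forall r : nat, r \in q <-> exists c, S c /\ resid n c.1 = r)].

Definition rec_rho (n : nat) (S : cellset) (r : int) (l : nat) : Prop :=
  exists s : seq cell,
    [/\ uniq s, (forall x, x \in s <-> S x /\ (1 <= x.1 <= n%:Z)),
        size s = l & r = \sum_(c <- s) (ceilz n c.2 - ceilz n c.1)].

(* AMBC n B P Q rho lam : iterating AMBC on the partial permutation B
   (given by its set of balls) terminates and outputs (P, Q, rho),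
   lam being the common shape *)
Inductive AMBC (n : nat) : cellset -> tabloid -> tabloid -> seq int -> seq nat -> Prop :=
| AMBC_nil (B : cellset) : (forall x, ~ B x) -> AMBC n B [::] [::] [::] [::]
| AMBC_cons (B B' S : cellset) p q r l P Q rho lam :
    (exists x, B x) -> ambc_step n B B' S -> rec_rows n S p q -> rec_rho n S r l ->
    AMBC n B' P Q rho lam -> AMBC n B (p :: P) (q :: Q) (r :: rho) (l :: lam).

Definition graph (f : int -> int) : cellset := fun x => f x.1 = x.2.

(* length: number of translation classes of pairs (a, b) of balls with
   a strictly northeast of b (representatives: row of a in [1, n]) *)
Definition affine_length (n : nat) (f : int -> int) (l : nat) : Prop :=
  ncard (fun ab : cell * cell =>
           [/\ graph f ab.1, graph f ab.2, sne ab.1 ab.2 & 1 <= ab.1.1 <= n%:Z]) l.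

Definition rowidx (T : tabloid) (x : nat) : nat := find (fun R => x \in R) T.

Definition inv_tab (n : nat) (T : tabloid) : nat :=
  \sum_(1 <= i < n.+1) \sum_(i.+1 <= j < n.+1) (rowidx T j < rowidx T i)%N.

(* inv(lambda) = lambda_2 + lambda_4 + ... *)
Definition inv_part (lam : seq nat) : nat :=
  \sum_(i < size lam | odd i) nth 0%N lam i.

Definition inv_rho (lam : seq nat) (rho : seq int) : int :=
  \sum_(i < size lam | odd (nth 0%N lam i)) nth 0 rho i.

Definition m1pow (z : int) : int := (-1) ^+ absz z.

(* Main.v *)
Require Import Defs.
From mathcomp Require Import all_boot all_order all_algebra.
From mathcomp Require Import zify.
From Stdlib Require Import Classical ClassicalEpsilon.
Import Order.TTheory GRing.Theory Num.Theory.
Local Open Scope ring_scope.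

(** Write [w i = sigma i + n a_i] on [1..n], with [sigma] a permutation of the residues.
    The left-hand side is the parity of [chi w = inv sigma + \sum_i a_i], because
    [len = \sum_(i < j) |floor ((w j - w i) / n)|] has the parity of
    [inv sigma + (n - 1) \sum_i a_i].

    One step of AMBC replaces the balls of each level by its back corner and its outer
    corners. These have the same rows, and their columns are those of the level rotated
    by one, so [chi] changes by (number of balls) - (number of levels), and these
    numbers add up to [inv lam] modulo 2. Separating the back corners from the outer corners
    contributes the inversions between one row and the lower rows of [P] and of [Q].
    The back corners form a chain, on which [sigma] is a rotation, and [chi] of that
    chain is [lam_1 * rho_1].

    This needs the distance [d] to be finite on all balls: a closed walk of [k] steps
    that winds [N] times around the cylinder satisfies [k <= N m], where [m] is the
    size of a channel. *)

(** * Residues and inversions *)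

(** Division with remainders in [[1, n]] rather than [[0, n - 1]], the convention that fits [resid]
    and [ceilz]. *)
Lemma euclid_uniq (n q q' r r' : int) :
  q * n + r = q' * n + r' -> 1 <= r <= n -> 1 <= r' <= n -> q = q' /\ r = r'.
Proof.
move=> e hr hr'.
have e0 : (q - q') * n = r' - r by rewrite mulrBl; lia.
have q0 : q = q'.
  case: (ltgtP q q') => // h; exfalso.
    have : 0 <= (q' - q - 1) * n by apply: mulr_ge0; lia.
    by rewrite !mulrBl mul1r => h1; move: e0; rewrite mulrBl; lia.
  have : 0 <= (q - q' - 1) * n by apply: mulr_ge0; lia.
  by rewrite !mulrBl mul1r => h1; move: e0; rewrite mulrBl; lia.
by split=> //; subst q'; lia.
Qed.

(** [ceilz] divides [- c] while [resid] divides [c - 1]; uniqueness of the division ties the two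
    quotients together. *)
Lemma resid_ceilzP (n : nat) (c : int) : (0 < n)%N ->
  c = (ceilz n c - 1) * n%:Z + (resid n c)%:Z /\ (0 < resid n c <= n)%N.
Proof.
move=> n0.
have nz : n%:Z != 0 by lia.
have h1 := divz_eq (- c) n%:Z; have h2 := divz_eq (c - 1) n%:Z.
have m1 := modz_ge0 (- c) nz; have m2 := modz_ge0 (c - 1) nz.
have l1 := ltz_pmod (- c) (d := n%:Z); have l2 := ltz_pmod (c - 1) (d := n%:Z).
rewrite /ceilz /resid.
move: (divz (- c) n) (modz (- c) n) (divz (c - 1) n) (modz (c - 1) n)
  h1 h2 m1 m2 l1 l2 => q r q' r' h1 h2 m1 m2 l1 l2.
have n0' : 0 < n%:Z by lia.
have {}l1 := l1 n0'; have {}l2 := l2 n0'.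
have [e1 e2] : - q - 1 = q' /\ n%:Z - r = r' + 1.
  apply: (@euclid_uniq n%:Z); rewrite ?mulrBl ?mulNr; lia.
by split; [rewrite e1; lia | lia].
Qed.

Lemma resid_ceilz_uniq (n : nat) (c q : int) (r : nat) :
  c = (q - 1) * n%:Z + r%:Z -> (0 < r <= n)%N -> ceilz n c = q /\ resid n c = r.
Proof.
move=> e hr.
have n0 : (0 < n)%N by lia.
have [e' hr'] := resid_ceilzP n c n0.
have [] : ceilz n c - 1 = q - 1 /\ (resid n c)%:Z = r%:Z.
  by apply: (@euclid_uniq n%:Z); [rewrite -e' -e | lia | lia].
lia.
Qed.

Lemma ceilz_resid_shift (n : nat) (c k : int) : (0 < n)%N ->
  ceilz n (c + k * n%:Z) = ceilz n c + k /\ resid n (c + k * n%:Z) = resid n c.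
Proof.
move=> n0; have [e hr] := resid_ceilzP n c n0.
by apply: resid_ceilz_uniq => //; rewrite {1}e addrAC mulrDl; lia.
Qed.

Lemma ceilz_resid_small (n : nat) (c : int) :
  1 <= c <= n%:Z -> ceilz n c = 1 /\ (resid n c)%:Z = c.
Proof.
move=> hc; have [|| -> ->] := @resid_ceilz_uniq n c 1 `|c|%N; lia.
Qed.

Fixpoint ninv (s : seq nat) : nat :=
  if s is x :: s' then (count (fun y => y < x)%N s' + ninv s')%N else 0%N.

Definition cross (s t : seq nat) : nat :=
  (\sum_(x <- s) count (fun y => y < x)%N t)%N.

Lemma cross_catl s1 s2 t : cross (s1 ++ s2) t = (cross s1 t + cross s2 t)%N.
Proof. by rewrite /cross big_cat. Qed.

Lemma cross_catr s t1 t2 : cross s (t1 ++ t2) = (cross s t1 + cross s t2)%N.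
Proof. by rewrite /cross -big_split; apply: eq_bigr => x _; rewrite count_cat. Qed.

Lemma cross_perm s s' t t' : perm_eq s s' -> perm_eq t t' -> cross s t = cross s' t'.
Proof.
move=> ps /permP pt; rewrite /cross (perm_big _ ps) /=.
by apply: eq_bigr => x _; rewrite pt.
Qed.

Lemma cross1 x t : cross [:: x] t = count (fun y => y < x)%N t.
Proof. by rewrite /cross big_seq1. Qed.

Lemma ninv_cat s t : ninv (s ++ t) = (ninv s + ninv t + cross s t)%N.
Proof.
elim: s => [|x s IH] /=; first by rewrite /cross big_nil addn0.
by rewrite IH count_cat -cat1s cross_catl cross1; lia.
Qed.

Lemma crossC s t : uniq (s ++ t) -> (cross s t + cross t s)%N = (size s * size t)%N.
Proof.
elim: s => [|x s IH] /=; first by rewrite /cross big_nil big1_seq.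
case/andP=> nx u.
rewrite -[x :: s]cat1s cross_catl cross_catr cross1 addnACA IH // mulSn.
congr addn; move: nx; rewrite mem_cat negb_or => /andP[_].
elim: t {IH u} => [|y t IH]; first by rewrite /cross big_nil.
rewrite inE negb_or => /andP[nxy nx]; rewrite -[y :: t]cat1s cross_catl cross1.
move: (IH nx); rewrite /=; lia.
Qed.

(** Moving [x] from the front to the end reverses its order with every entry of [s], and with
    nothing else. *)
Lemma odd_ninv_rcons x s : uniq (x :: s) ->
  odd (ninv (rcons s x)) = odd (ninv (x :: s)) (+) odd (size s).
Proof.
move=> u; rewrite -cats1 -[x :: s]cat1s !ninv_cat.
have := @crossC [:: x] s u; rewrite mul1n /=; lia.
Qed.

(** Swapping two adjacent blocks changes each inversion number by the product of their sizes modulo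
    2, the same for [g] and [h]. The combined parity is thus independent of the order in which balls
    are listed. *)
Lemma odd_ninv_perm (T : eqType) (g h : T -> nat) (s t : seq T) :
  perm_eq s t -> uniq (map g s) -> uniq (map h s) ->
  odd (ninv (map g s)) (+) odd (ninv (map h s)) =
  odd (ninv (map g t)) (+) odd (ninv (map h t)).
Proof.
move=> pst ug uh.
pose b := odd (ninv (map g s)) (+) odd (ninv (map h s)).
suff [] : [/\ uniq (map g t), uniq (map h t) &
  b = odd (ninv (map g t)) (+) odd (ninv (map h t))] by [].
apply: (@catCA_perm_ind _ (fun t => [/\ uniq (map g t), uniq (map h t) &
  b = odd (ninv (map g t)) (+) odd (ninv (map h t))]) _ _ _ pst) => //.
move=> s1 s2 s3 []; rewrite !map_cat => u1 u2 e.
split; rewrite ?(uniq_catCA (map _ s2)) // e !ninv_cat !cross_catr.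
have := u1; rewrite catA cat_uniq => /andP[/crossC + _].
have := u2; rewrite catA cat_uniq => /andP[/crossC + _].
rewrite !size_map; move: (_ * _)%N => k; lia.
Qed.

(** * Closed walks on the cylinder *)

Lemma int_switch (P : pred int) (a b : int) :
  a <= b -> P a -> ~~ P b -> exists q : int, [/\ a < q, q <= b, P (q - 1) & ~~ P q].
Proof.
move=> ab Pa; have [d ->] : exists d : nat, b = a + d%:Z by exists `|b - a|%N; lia.
elim: d => [|d IH]; first by rewrite addr0 Pa.
case: (boolP (P (a + d%:Z))) => [Pd nP|/IH[q [h1 h2 h3 h4]] _].
  exists (a + d.+1%:Z); split; [lia | lia | | by []].
  by rewrite (_ : _ - 1 = a + d%:Z) //; lia.
by exists q; split=> //; lia.
Qed.

Section IncreasingSequences.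
Variable u : int -> int.
Hypothesis uS : forall i : int, u i < u (i + 1).

Lemma incr_ltW (i j : int) : i < j -> u i < u j.
Proof.
move=> ij; have -> : j = i + (`|j - i|.-1).+1%:Z by lia.
elim: (`|j - i|.-1) => [|d IH]; first exact: uS.
by apply: lt_trans IH _; have := uS (i + d.+1%:Z); congr (_ < u _); lia.
Qed.

Lemma incr_lt (i j : int) : (u i < u j) = (i < j).
Proof.
case: (ltgtP i j) => [/incr_ltW->//|/incr_ltW h|->]; last by rewrite ltxx.
by apply/negbTE; rewrite -leNgt ltW.
Qed.

Lemma incr_le (i j : int) : (u i <= u j) = (i <= j).
Proof. by rewrite leNgt incr_lt -leNgt. Qed.

Variables k h : int.
Hypothesis up : forall i : int, u (i + k) = u i + h.

Lemma periodM (i c : int) : u (i + c * k) = u i + c * h.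
Proof.
have pos (d : nat) (j : int) : u (j + d%:Z * k) = u j + d%:Z * h.
  elim: d => [|d IH]; first by rewrite !mul0r !addr0.
  by rewrite -addn1 PoszD !mulrDl !mul1r addrA up IH addrA.
case: (lerP 0 c) => hc; first by rewrite (_ : c = `|c|%N%:Z) ?pos //; lia.
have := pos `|c|%N (i + c * k); rewrite -addrA -mulrDl.
rewrite (_ : c + `|c|%N%:Z = 0) ?mul0r ?addr0; last lia.
by move=> ->; rewrite -addrA -mulrDl (_ : _ + c = 0) ?mul0r ?addr0; lia.
Qed.
End IncreasingSequences.

Section Exchange.
Variables (n N k : int).
Hypotheses (n0 : 0 < n) (N2 : 2 <= N).

(** With [u] and [v] the rows and columns of a walk, cell [q] of its translate lies weakly northeast
    of both ends of the step from [p - 1] to [p]. Swapping [u] and [v] gives southwest. *)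
Definition stuck (u v : int -> int) (p : int) := exists q : int,
  [/\ u (q - 1) + n < u p, v (q - 1) + n < v p, u q + n <= u (p - 1) & v p <= v q + n].

(** If the blocking cell changed sides between consecutive steps, monotonicity would force
    [u (p + 1) <= u (p - 1)]. *)
Lemma stuckS (u v : int -> int) (p : int) :
  (forall i : int, u i < u (i + 1)) -> (forall i : int, v i < v (i + 1)) ->
  stuck u v p -> ~ stuck v u (p + 1).
Proof.
move=> uS vS [q [_ _ h1 h2]] [q' [_ _]]; rewrite addrK => h3 h4.
have : q' <= q by rewrite -(incr_le v vS); lia.
rewrite -(incr_le u uS) => h5.
have := incr_ltW u uS (p - 1) (p + 1); lia.
Qed.

Lemma drift_absurd (u v : int -> int) :
  (forall i : int, u i < u (i + 1)) -> (forall i : int, v i < v (i + 1)) ->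
  (forall i : int, u (i + k) = u i + N * n) -> (forall i : int, v (i + k) = v i + N * n) ->
  (forall p : int, 0 <= p -> stuck u v p) -> False.
Proof.
move=> uS vS uk vk st.
have Nn : 0 < N * n by apply: mulr_gt0; lia.
have k0 : 0 < k by have := incr_lt u uS 0 k; have := uk 0; rewrite add0r => ->; lia.
(* Periodicity extends the blocking cells to negative indices; only the side on which they lie is
   kept. *)
have one (p : int) : exists q : int, u q + n < u p /\ v p <= v q + n.
  have [c hc] : exists c : int, 0 <= p + c * k.
    exists `|p|%N%:Z; have : 0 <= `|p|%N%:Z * (k - 1) by apply: mulr_ge0; lia.
    by rewrite mulrBr; lia.
  have [q [_ _ h1 h2]] := st _ hc.
  exists (q + - c * k); rewrite !(periodM _ _ _ uk, periodM _ _ _ vk).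
  move: h1 h2; rewrite [p + _ - 1]addrAC !(periodM _ _ _ uk, periodM _ _ _ vk) mulNr.
  by have := uS (p - 1); rewrite subrK; move: (u _) (u _) (u _) (v _) (v _); lia.
(* After [N] iterations the translate is by [N * n], which is the walk itself reindexed by [k]; it
   cannot lie strictly on one side of itself. *)
have many (j : nat) (p : int) : exists q : int, u q + j.+1%:Z * n < u p /\ v p <= v q + j.+1%:Z * n.
  elim: j p => [|j IH] p; first by rewrite !mul1r.
  have [q [h1 h2]] := IH p; have [q' [h3 h4]] := one q.
  by exists q'; rewrite -(addn1 j.+1) PoszD !mulrDl !mul1r; lia.
have [q] := many `|N|.-1 0.
rewrite (_ : _%:Z = N); last lia.
rewrite -uk -vk (incr_lt u uS) (incr_le v vS); lia.
Qed.

(* Two bi-infinite increasing lattice paths, one the translate of the other by [n],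
   admit an exchange of steps: otherwise one would lie strictly on one side of
   the other, and so would all its further translates, including itself. *)
Lemma exchange (u v : int -> int) :
  (forall i : int, u i < u (i + 1)) -> (forall i : int, v i < v (i + 1)) ->
  (forall i : int, u (i + k) = u i + N * n) -> (forall i : int, v (i + k) = v i + N * n) ->
  exists p q : int, [/\ u (p - 1) < u q + n, v (p - 1) < v q + n,
                  u (q - 1) + n < u p & v (q - 1) + n < v p].
Proof.
move=> uS vS uk vk; apply: NNPP => noex.
have nN : n <= (N - 1) * n by have := mulr_ge0 (_ : 0 <= N - 2) (ltW n0);
  rewrite !mulrBl => H; have := H ltac:(lia); lia.
have k0 : 0 < k by have := incr_lt u uS 0 k; have := uk 0; rewrite add0r => ->;
  move: nN; rewrite mulrBl; lia.
have dich (p : int) : stuck u v p \/ stuck v u p.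
  pose P (q : int) := (u q + n < u p) && (v q + n < v p).
  (* [P] holds at [p - k - 1], because a full period advances by [N * n] with [N >= 2], and fails at
     [p]; [q] is where it switches. *)
  have [q [_ _ /andP[q1 q2] Pq]] : exists q : int, [/\ p - k - 1 < q, q <= p, P (q - 1) & ~~ P q].
    apply: int_switch; first lia.
      rewrite /P; have := incr_ltW u uS (p - k - 1) (p - k).
      have := incr_ltW v vS (p - k - 1) (p - k).
      have := uk (p - k); have := vk (p - k); rewrite !subrK => -> ->.
      by move: nN; rewrite mulrBl; lia.
    by rewrite /P; lia.
  have e : ~ (u (p - 1) < u q + n /\ v (p - 1) < v q + n) by
    move=> [? ?]; apply: noex; exists p, q.
  have := uS (p - 1); have := vS (p - 1); rewrite subrK => h1 h2.
  move: Pq; rewrite /P => Pq.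
  case: (ltrP (u (p - 1)) (u q + n)) => h3.
    by right; exists q; split=> //; lia.
  by left; exists q; split=> //; lia.
case: (dich 0) => st.
  apply: (@drift_absurd u v) => // p p0; rewrite (_ : p = `|p|%N%:Z); last lia.
  elim: `|p|%N => // j IH; rewrite -addn1 PoszD.
  by case: (dich (j%:Z + 1)) => // st'; case: (stuckS u v _ uS vS IH).
apply: (@drift_absurd v u) => // p p0; rewrite (_ : p = `|p|%N%:Z); last lia.
elim: `|p|%N => // j IH; rewrite -addn1 PoszD.
by case: (dich (j%:Z + 1)) => // st'; case: (stuckS v u _ vS uS IH).
Qed.
End Exchange.

(** * Translations of cells and periodic chains *)

Definition sh (n : nat) (k : int) (x : cell) : cell :=
  (x.1 + k * n%:Z, x.2 + k * n%:Z).

Lemma sh0 n x : sh n 0 x = x.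
Proof. by case: x => a b; rewrite /sh mul0r !addr0. Qed.

Lemma shD n k l x : sh n k (sh n l x) = sh n (k + l) x.
Proof. by rewrite /sh /= mulrDl; congr pair; lia. Qed.

Lemma shK n k : cancel (sh n k) (sh n (- k)).
Proof. by move=> x; rewrite shD addNr sh0. Qed.

Lemma sh_inj n k : injective (sh n k).
Proof. exact: can_inj (shK n k). Qed.

Lemma snwb_sh n k a b : snwb (sh n k a) (sh n k b) = snwb a b.
Proof. by rewrite /snwb /sh /= !ltrD2r. Qed.

Lemma snwb_shr n k a b : (0 < n)%N -> 0 <= k -> snwb a b -> snwb a (sh n k b).
Proof.
move=> n0 k0; have : 0 <= k * n%:Z by apply: mulr_ge0.
rewrite /snwb /sh /=; lia.
Qed.

Lemma snwb_shl n k a b : (0 < n)%N -> k <= 0 -> snwb a b -> snwb (sh n k a) b.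
Proof.
move=> n0 k0; have : 0 <= (- k) * n%:Z by apply: mulr_ge0; lia.
rewrite /snwb /sh /= mulNr; lia.
Qed.

Lemma snwb_far n a b : (0 < n)%N -> exists k : int, 0 < k /\ snwb a (sh n k b).
Proof.
move=> n0; pose K := (`|a.1 - b.1|%N + `|a.2 - b.2|%N + 1)%N; exists K%:Z; split; first lia.
have h : K%:Z <= K%:Z * n%:Z by rewrite -{1}(mulr1 K%:Z); apply: ler_wpM2l; lia.
rewrite /snwb /sh /=; move: h; rewrite /K; move: (_ * _); lia.
Qed.

Lemma trinv_sh n B : trinv n B -> forall k x, B x -> B (sh n k x).
Proof.
move=> tB.
have one x : B (sh n 1 x) <-> B x by have := tB x; rewrite /sh !mul1r; tauto.
have pos (k : nat) x : B (sh n k%:Z x) <-> B x.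
  elim: k x => [|k IH] x; first by rewrite sh0.
  by rewrite -addn1 PoszD addrC -shD one.
move=> k x Bx; case: (lerP 0 k) => k0.
  by rewrite (_ : k = `|k|%N%:Z); [apply/pos | lia].
by apply/(pos `|k|%N); rewrite shD (_ : _ + k = 0) ?sh0 //; lia.
Qed.

(** [t0] is the last index with value at most [0]; by periodicity [t0 + k] is the last one with
    value at most [n]. *)
Lemma window (n k : int) (u : int -> int) : 0 < n ->
  (forall i : int, u i < u (i + 1)) -> (forall i : int, u (i + k) = u i + n) ->
  exists t0 : int, forall i : int, (1 <= u i <= n) = (t0 < i <= t0 + k).
Proof.
move=> n0 uS uk.
have [c [c0 c1 c2]] : exists c : int, [/\ 0 <= c, u 0 <= c & - u 0 <= c].
  by move: (u 0) => z; exists `|z|%N%:Z; split; lia.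
have cn : 0 <= c * (n - 1) by apply: mulr_ge0; lia.
have a0 : u (- c * k) <= 0.
  have := periodM u k n uk 0 (- c); rewrite add0r => ->.
  by move: cn; rewrite mulrBr mulNr mulr1; lia.
have b0 : 0 < u ((c + 1) * k).
  have := periodM u k n uk 0 (c + 1); rewrite add0r => ->.
  by move: cn; rewrite mulrBr mulrDl mulr1 mul1r; lia.
have ab : - c * k <= (c + 1) * k.
  by rewrite ltW // -(incr_lt u uS); apply: le_lt_trans a0 b0.
have nb : ~~ (u ((c + 1) * k) <= 0) by rewrite -ltNge.
have [q [_ _ q1 q2]] := @int_switch (fun i => u i <= 0) _ _ ab a0 nb.
exists (q - 1) => i.
have e1 : (1 <= u i) = (q - 1 < i).
  apply/idP/idP => h; first by rewrite -(incr_lt u uS); lia.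
  have : q <= i by lia.
  by rewrite -(incr_le u uS); lia.
rewrite e1; congr andb; have := uk (q - 1); have := uk q => h1 h2.
apply/idP/idP => h; last by move: h; rewrite -(incr_le u uS); lia.
suff : i < q + k by lia.
by rewrite -(incr_lt u uS); lia.
Qed.

(** The window is half-open, [t0 < i <= t0 + k], the form that [window] delivers. *)
Definition segment {T : Type} (b : int -> T) (t0 : int) (k : nat) : seq T :=
  [seq b (t0 + i.+1%:Z) | i <- iota 0 k].

Lemma segmentP (T : eqType) (b : int -> T) (t0 : int) (k : nat) x :
  reflect (exists2 i, t0 < i <= t0 + k%:Z & x = b i) (x \in segment b t0 k).
Proof.
apply: (iffP mapP) => [[i]|[i hi ->]].
  by rewrite mem_iota => hi ->; exists (t0 + i.+1%:Z) => //; lia.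
exists `|i - t0|.-1; first by rewrite mem_iota; lia.
by congr b; lia.
Qed.

Section PeriodicChains.
Variables (n : nat) (B : cellset).
Hypotheses (n0 : (0 < n)%N) (BT : trinv n B).

(** A closed walk on the cylinder of cells modulo translation, unrolled: [k] is its number of steps
    and [N] its winding number. *)
Definition pchain (b : int -> cell) (k N : int) : Prop :=
  [/\ forall i : int, B (b i), forall i : int, snwb (b i) (b (i + 1)) &
      forall i : int, b (i + k) = sh n N (b i)].

Lemma pchain_incr1 b (k N : int) : pchain b k N -> forall i : int, (b i).1 < (b (i + 1)).1.
Proof. by case=> _ h _ i; have /andP[] := h i. Qed.

Lemma pchain_incr2 b (k N : int) : pchain b k N -> forall i : int, (b i).2 < (b (i + 1)).2.
Proof. by case=> _ h _ i; have /andP[] := h i. Qed.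

Lemma pchain_per1 b (k N : int) : pchain b k N -> forall i : int, (b (i + k)).1 = (b i).1 + N * n%:Z.
Proof. by case=> _ _ h i; rewrite h. Qed.

Lemma pchain_per2 b (k N : int) : pchain b k N -> forall i : int, (b (i + k)).2 = (b i).2 + N * n%:Z.
Proof. by case=> _ _ h i; rewrite h. Qed.

Lemma pchain_snwb b (k N : int) : pchain b k N -> forall i j : int, snwb (b i) (b j) = (i < j).
Proof.
move=> hb i j; rewrite /snwb (incr_lt (fun i => (b i).1) (pchain_incr1 _ _ _ hb)).
by rewrite (incr_lt (fun i => (b i).2) (pchain_incr2 _ _ _ hb)) andbb.
Qed.

Lemma pchain_inj b (k N : int) : pchain b k N -> injective b.
Proof.
clear n0; move=> hb i j e; case: (ltgtP i j) => //; rewrite -(pchain_snwb _ _ _ hb) e /snwb; lia.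
Qed.

Lemma pchain_window b (k : int) : pchain b k 1 ->
  exists t0 : int, forall i : int, (1 <= (b i).1 <= n%:Z) = (t0 < i <= t0 + k).
Proof.
move=> hb; apply: (@window n%:Z k (fun i => (b i).1)); first lia.
  exact: pchain_incr1 hb.
by move=> i; rewrite (pchain_per1 _ _ _ hb) mul1r.
Qed.

Lemma pchain_segment_uniq b k N t0 l : pchain b k N -> uniq (segment b t0 l).
Proof.
clear n0; move=> hb; rewrite map_inj_uniq ?iota_uniq // => i j /(pchain_inj _ _ _ hb); lia.
Qed.

Lemma pchain_ncl b (k : int) X : 0 < k -> pchain b k 1 ->
  (forall x, X x <-> exists i : int, x = b i) -> ncl n X `|k|%N.
Proof.
move=> k0 hb hX; have [t0 ht] := pchain_window _ _ hb.
exists (segment b t0 `|k|%N); split; last by rewrite size_map size_iota.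
  exact: pchain_segment_uniq hb.
move=> x; split=> [/segmentP[i hi ->]|[/hX[i ->]]].
  by rewrite ht; split; [apply/hX; exists i | lia].
by rewrite ht => hi; apply/segmentP; exists i => //; lia.
Qed.

Lemma pchain_chainset b (k : int) X : pchain b k 1 ->
  (forall x, X x <-> exists i : int, x = b i) -> chainset n B X.
Proof.
clear n0; move=> hb hX; have [Bb _ bk] := hb; split.
- by move=> x /hX[i ->].
- move=> x; rewrite (_ : (_, _) = sh n 1 x); last by rewrite /sh mul1r.
  split=> /hX[i e]; apply/hX; first by exists (i + k); rewrite bk e.
  by exists (i - k); apply: (@sh_inj n 1); rewrite e -bk subrK.
- move=> x y /hX[i ->] /hX[j ->].
  have := pchain_snwb _ _ _ hb i j; have := pchain_snwb _ _ _ hb j i.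
  rewrite /snwb /nw; case: (ltgtP i j) => [||->]; first by left; lia.
    by right; lia.
  by left; lia.
Qed.

(** Cell [q * k + r] of the unrolled walk is the translate of [g r] by [N * q]; the last hypothesis
    is the closing step. *)
Lemma pchain_of_walk (g : int -> cell) (k N : int) : 0 < k ->
  (forall i : int, 0 <= i < k -> B (g i)) ->
  (forall i : int, 0 <= i < k - 1 -> snwb (g i) (g (i + 1))) ->
  snwb (g (k - 1)) (sh n N (g 0)) -> exists b, pchain b k N.
Proof.
clear n0; move=> k0 gB gS gN.
pose b (i : int) := sh n (N * (i %/ k)%Z) (g (i %% k)%Z).
have bE (q r : int) : 0 <= r < k -> b (q * k + r) = sh n (N * q) (g r).
  move=> hr; rewrite /b divzMDl ?modzMDl; last lia.
  by rewrite divz_small ?modz_small ?addr0 //; lia.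
have iE (i : int) : exists q r : int, 0 <= r < k /\ i = q * k + r.
  exists (i %/ k)%Z, (i %% k)%Z; split; last exact: divz_eq.
  by rewrite modz_ge0 ?ltz_pmod //; lia.
exists b; split=> i; have [q [r [hr ->]]] := iE i.
- by rewrite bE //; apply: trinv_sh => //; apply: gB.
- rewrite bE //; case: (ltrP r (k - 1)) => hr1.
    by rewrite -addrA bE ?snwb_sh; [apply: gS | ]; lia.
  rewrite (_ : q * k + r + 1 = (q + 1) * k + 0); last by rewrite mulrDl; lia.
  rewrite bE; last lia.
  by rewrite mulrDr mulr1 -shD snwb_sh (_ : r = k - 1) //; lia.
- rewrite (_ : q * k + r + k = (q + 1) * k + r); last by rewrite mulrDl; lia.
  by rewrite !bE // shD mulrDr mulr1 addrC.
Qed.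

Variable m : int.
Hypothesis hm : forall b (k : int), 0 < k -> pchain b k 1 -> k <= m.

(* Exchanging steps between a walk and its translate splits off a walk of winding number one. *)
Lemma pchain_bound (N : nat) b (k : int) : 0 < k -> pchain b k N.+1 -> k <= m * N.+1%:Z.
Proof.
elim: N b k => [|N IH] b k k0 hb; first by rewrite mulr1; apply: hm hb.
have [bB bS bk] := hb.
have [p [q [h1 h2 h3 h4]]] := @exchange n%:Z N.+2 k ltac:(lia) ltac:(lia)
  (fun i => (b i).1) (fun i => (b i).2)
  (pchain_incr1 _ _ _ hb) (pchain_incr2 _ _ _ hb)
  (pchain_per1 _ _ _ hb) (pchain_per2 _ _ _ hb).
have hpq : snwb (b (p - 1)) (sh n 1 (b q)) by rewrite /snwb /sh /= !mul1r h1 h2.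
have hqp : snwb (sh n 1 (b (q - 1))) (b p) by rewrite /snwb /sh /= !mul1r h3 h4.
have qp : q - 1 < p.
  rewrite -(pchain_snwb _ _ _ hb).
  by have := snwb_shl n (-1) _ _ n0 isT hqp; rewrite shK.
have pq : p - 1 < q + k.
  rewrite -(pchain_snwb _ _ _ hb) bk.
  have := snwb_shr n N.+1 _ _ n0 isT hpq.
  by rewrite shD (_ : N.+1%:Z + 1 = N.+2); last lia.
(* First loop: cells [q] to [p - 1], winding once. When [p = q] it is empty and only [0 <= m]
   remains, which holds because a single ball repeated is a closed walk of one step. *)
have le1 : p - q <= m.
  case: (ltrP q p) => [qp'|]; last first.
    move=> pq'; suff : 0 <= m by lia.
    case: (ltrP 0 m) => [/ltW//|m0].
    have h0 : 0 < 1 :> int by [].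
    have [|||b' hb'] := @pchain_of_walk (fun _ => b 0) 1 1 h0; rewrite ?subrr //; try lia.
      by rewrite /snwb /sh /=; lia.
    by have := hm _ _ h0 hb'; lia.
  have [||||b' hb'] := @pchain_of_walk (fun i => b (q + i)) (p - q) 1.
  - lia.
  - by [].
  - by move=> i _; rewrite addrA.
  - by rewrite addr0 (_ : q + _ = p - 1) //; lia.
  by apply: hm hb'; lia.
(* Second loop: cells [p] to [q + k - 1], with the remaining [N.+1] windings, bounded by
   induction. *)
have le2 : k - (p - q) <= m * N.+1%:Z.
  case: (ltrP p (q + k)) => [qp'|h]; last first.
    suff : 0 <= m * N.+1%:Z by lia.
    by apply: mulr_ge0; lia.
  have [||||b' hb'] := @pchain_of_walk (fun i => b (p + i)) (k - (p - q)) N.+1.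
  - lia.
  - by [].
  - by move=> i _; rewrite addrA.
  - rewrite addr0 (_ : p + _ = q - 1 + k); last lia.
    by rewrite bk (_ : N.+2%:Z = N.+1%:Z + 1) -?shD ?snwb_sh //; lia.
  by apply: IH hb'; lia.
by rewrite (_ : N.+2%:Z = N.+1%:Z + 1) ?mulrDr; lia.
Qed.
End PeriodicChains.

(** * The distance to a channel *)

Lemma int_max (P : int -> Prop) (M t : int) :
  P t -> (forall x, P x -> x <= M) -> exists2 x, P x & forall y, P y -> y <= x.
Proof.
move=> Pt hM; have [k hk] : exists k : nat, M - t <= k%:Z by exists `|M - t|%N; lia.
elim: k t Pt hk => [|k IH] t Pt hk.
  by exists t => // y /hM; lia.
case: (classic (exists2 y, P y & t < y)) => [[y Py ty]|no].
  by apply: IH Py _; lia.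
by exists t => // y Py; rewrite leNgt; apply/negP => ty; apply: no; exists y.
Qed.

(** Surjectivity leaves no gap between [f i] and [f (i + 1)]. For the numbering of a channel this
    shows that translation raises the number by a constant. *)
Lemma incr_onto_translation (f : int -> int) :
  (forall i j : int, i < j -> f i < f j) -> (forall t : int, exists i : int, f i = t) ->
  forall i : int, f i = f 0 + i.
Proof.
move=> fS fsurj.
have f1 (i : int) : f (i + 1) = f i + 1.
  have [j fj] := fsurj (f i + 1).
  have ij : i < j.
    rewrite ltNge; apply/negP; rewrite le_eqVlt => /orP[/eqP e|/fS]; last lia.
    by subst; lia.
  have := fS i (i + 1) ltac:(lia); case: (ltgtP (i + 1) j) => [/fS||e]; [lia | lia |].
  by rewrite e fj.
move=> i; have pos (k : nat) (j : int) : f (j + k%:Z) = f j + k%:Z.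
  elim: k => [|k IH]; first by rewrite !addr0.
  by rewrite -addn1 PoszD addrA f1 IH addrA.
case: (lerP 0 i) => hi; first by have := pos `|i|%N 0; rewrite add0r (_ : `|i|%N%:Z = i) //; lia.
by have := pos `|i|%N i; rewrite (_ : i + `|i|%N%:Z = 0); lia.
Qed.

Section Distance.
Variables (n : nat) (B : cellset).
Hypotheses (n0 : (0 < n)%N) (BT : trinv n B).
Hypothesis Brow : forall a b, B a -> B b -> a.1 = b.1 -> a = b.
Hypothesis Bcol : forall a b, B a -> B b -> a.2 = b.2 -> a = b.

Lemma pchain_sh b (k N c i : int) : pchain n B b k N -> b (i + c * k) = sh n (c * N) (b i).
Proof.
move=> hb.
have e1 := periodM (fun i => (b i).1) _ _ (pchain_per1 _ _ _ _ _ hb) i c.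
have e2 := periodM (fun i => (b i).2) _ _ (pchain_per2 _ _ _ _ _ hb) i c.
by rewrite (surjective_pairing (b (i + _))) /= e1 e2 /sh -!mulrA.
Qed.

Variables (C : cellset) (dt : cell -> int).
Hypothesis chC : channel n B C.
Hypothesis numC : numbering C dt.

(** The numbering is inverted to parametrize the channel by [g]. The period [m] is its number of
    translation classes, so maximality of the channel becomes a bound on closed walks that wind
    once. *)
Lemma channel_pchain : exists (g : int -> cell) (m : int),
  [/\ 0 < m, pchain n B g m 1, (forall x, C x <-> exists i : int, x = g i),
      (forall i : int, dt (g i) = i) &
      (forall b (k : int), 0 < k -> pchain n B b k 1 -> k <= m)].
Proof.
have [[CB CT Cch] [K [nclK maxK]]] := chC.
have [dtlt dtsurj] := numC.
have [g hg] : exists g : int -> cell, forall i : int, C (g i) /\ dt (g i) = i.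
  exists (fun i => epsilon (inhabits (0, 0)) (fun c => C c /\ dt c = i)) => i.
  exact: epsilon_spec (dtsurj i).
have Cg i : C (g i) by case: (hg i).
have dg i : dt (g i) = i by case: (hg i).
have dtlt' a b : C a -> C b -> snwb a b -> dt a < dt b.
  move=> Ca Cb /andP[h1 h2]; apply: dtlt => //; last by split; apply: ltW.
  by move=> e; move: h1; rewrite e ltxx.
(* Distinct balls share no row and no column, so the weak order on the channel is strict. *)
have nwg a b : C a -> C b -> dt a < dt b -> snwb a b.
  move=> Ca Cb ab.
  have nab : a <> b by move=> e; move: ab; rewrite e ltxx.
  have [[h1 h2]|h] := Cch a b Ca Cb; last first.
    have ba := dtlt _ _ Cb Ca (fun e => nab (esym e)) h.
    by have := lt_trans ab ba; rewrite ltxx.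
  rewrite /snwb !lt_neqAle h1 h2 !andbT; apply/andP; split; apply/eqP => e; apply: nab.
    by apply: Brow => //; apply: CB.
  by apply: Bcol => //; apply: CB.
have gd c : C c -> g (dt c) = c.
  move=> Cc; apply: NNPP => ne.
  have [h1|h1] := Cch _ _ Cc (Cg (dt c)).
    by have := dtlt _ _ Cc (Cg _) (fun e => ne (esym e)) h1; rewrite dg ltxx.
  by have := dtlt _ _ (Cg _) Cc ne h1; rewrite dg ltxx.
have CT' := trinv_sh _ _ CT.
pose m := dt (sh n 1 (g 0)).
have gm (i : int) : dt (sh n 1 (g i)) = m + i.
  apply: (incr_onto_translation (fun i => dt (sh n 1 (g i)))) => {i}.
    move=> i j ij; apply: dtlt'; try exact: CT'.
    by rewrite snwb_sh; apply: nwg => //; rewrite !dg.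
  move=> t; exists (dt (sh n (-1) (g t))).
  by rewrite gd; [rewrite shD addrN sh0 dg | exact: CT'].
have m0 : 0 < m.
  rewrite -(dg 0); apply: dtlt' => //; first exact: CT'.
  by rewrite /snwb /sh /=; lia.
have pg : pchain n B g m 1.
  split=> i; first exact: CB.
    by apply: nwg => //; rewrite !dg; lia.
  by rewrite -(gd (sh n 1 (g i))) ?gm 1?addrC //; apply: CT'.
have CgP x : C x <-> exists i : int, x = g i.
  by split=> [Cx|[i ->]] //; exists (dt x); rewrite gd.
exists g, m; split=> // b k k0 hb.
have [s [us hs sz]] := nclK.
have [s' [us' hs' sz']] := pchain_ncl n B n0 g m C m0 pg CgP.
have szK : K = `|m|%N.
  rewrite -sz -sz'; apply/perm_size/uniq_perm => // x.
  by apply/idP/idP => [/hs/hs'|/hs'/hs].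
pose X x := exists i : int, x = b i.
have := maxK X _ (pchain_chainset n B b k X hb (fun x => iff_refl _))
  (pchain_ncl n B n0 b k X k0 hb (fun x => iff_refl _)).
lia.
Qed.

(** Followed backwards and closed up along the channel, the path becomes a closed walk;
    [pchain_bound] forbids it from being longer than the channel run with the same winding. *)
Lemma dpath_le g (m : int) c s : 0 < m -> pchain n B g m 1 ->
  (forall x, C x <-> exists i : int, x = g i) -> (forall i : int, dt (g i) = i) ->
  (forall b (k : int), 0 < k -> pchain n B b k 1 -> k <= m) ->
  C c -> dpath B C c s -> dt (last c s) + (size s)%:Z <= dt c.
Proof.
move=> m0 pg CgP dg hm Cc [sB sp /CgP[j ej]].
have [i ei] := (CgP c).1 Cc.
rewrite ej ei !dg.
case: (posnP (size s)) => [/size0nil s0|s0].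
  have : g i = g j by rewrite -ei -ej s0.
  by move=> /(pchain_inj _ _ _ _ _ pg) ->; rewrite s0 addr0.
have [gB gS gm] := pg.
(* Enough windings are taken for the part along the channel to have a positive number [R] of
   steps. *)
have [J hJ] : exists J : nat, `|i - j| <= J%:Z by exists `|i - j|%N; lia.
have [R eR] : exists R : int, R = j - i + J.+1%:Z * m by eexists.
have R0 : 0 < R.
  have : 0 <= J.+1%:Z * (m - 1) by apply: mulr_ge0; lia.
  by rewrite mulrBr mulr1; lia.
have [K eK] : exists K : int, K = R + (size s)%:Z by eexists.
(* The walk runs along the channel up to [g j], then back along [s]. The index [K - r] stops at 1,
   since the closing step reaches [c], a translate of the start. *)
pose h (r : int) := if r < R then g (i - J.+1%:Z * m + r) else nth c (c :: s) `|K - r|%N.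
have hR (r : int) : r = R -> h r = g j.
  move=> ->; rewrite /h ltxx (_ : `|K - R|%N = size s); last lia.
  by rewrite -ej -nth_last; case: (s) s0.
have K0 : 0 < K by lia.
have [r hr|r hr||b hb] := @pchain_of_walk n B BT h K J.+1%:Z K0.
- rewrite /h; case: ltrP => // rR.
  have [z ->] : exists z : nat, `|K - r|%N = z.+1 by exists `|K - r|%N.-1; lia.
  by case: (leqP (size s) z) => hz; [rewrite nth_default // ei | apply/sB/mem_nth].
- case: (ltrP r R) => rR; last first.
    rewrite /h !ifF; try lia.
    have [z [e1 e2 zs]] : exists z : nat,
        [/\ `|K - r|%N = z.+1, `|K - (r + 1)%R|%N = z & (z < size s)%N].
      by exists `|K - (r + 1)%R|%N; split; lia.
    by rewrite e1 e2 /=; have /pathP := sp => /(_ c z zs).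
  case: (ltrP (r + 1) R) => rR'.
    by rewrite /h rR rR' addrA.
  rewrite (hR (r + 1)) /h ?rR; last lia.
  have := gS (i - J.+1%:Z * m + r); rewrite (_ : _ + r + 1 = j) //; lia.
- rewrite {2}/h R0 addr0 -mulNr (pchain_sh _ _ _ _ _ pg) shD mulr1 addrN sh0 -ei /h ifF; last lia.
  rewrite (_ : `|_|%N = 1%N); last lia.
  by have /pathP := sp => /(_ c 0%N s0).
have := pchain_bound n B n0 BT m hm J b K K0 hb.
rewrite eK eR [m * _]mulrC; lia.
Qed.

(* A ball has infinite distance only if some closed walk beats the channel, which
   [dpath_le] excludes. *)
Lemma distance_exists : exists (d : cell -> int) (m : int),
  [/\ 0 < m,
      (forall x, B x -> dval B C dt x (d x)),
      (forall x (k : int), B x -> d (sh n k x) = d x + k * m),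
      (forall x y, B x -> B y -> snwb x y -> d x < d y) &
      (forall x, B x -> exists y, [/\ B y, snwb y x & d y = d x - 1])].
Proof.
have [g [m [m0 pg CgP dg hm]]] := channel_pchain.
have [gB gS gm] := pg.
have Cg i : C (g i) by apply/CgP; exists i.
have BS := trinv_sh _ _ BT.
have gsh (i k : int) : sh n k (g i) = g (i + k * m).
  by rewrite (pchain_sh _ _ _ _ _ pg) mulr1.
have ex x : B x -> exists t, dval B C dt x t.
  move=> Bx.
  have [k [_ hk]] := snwb_far n (g 0) x n0.
  have [l [_ hl]] := snwb_far n x (g 0) n0.
  have pk : dpath B C x [:: sh n (- k) (g 0)].
    split; last by rewrite /= gsh; exact: Cg.
      by move=> y; rewrite inE => /eqP ->; apply: BS.
    by rewrite /= andbT -(snwb_sh n k) shD addrN sh0.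
  pose P t := exists s, dpath B C x s /\ dt (last x s) + (size s)%:Z = t.
  (* A path from [x] exists, to a channel ball far northwest. Paths are bounded because a channel
     ball far southeast, put in front, makes them join two channel balls. *)
  have [||t Pt tmax] := @int_max P (dt (sh n l (g 0))) (dt (sh n (- k) (g 0)) + 1).
  - by exists [:: sh n (- k) (g 0)].
  - move=> t [s [[sB sp sC] <-]].
    have := dpath_le g m (sh n l (g 0)) (x :: s) m0 pg CgP dg hm.
    rewrite /= => h; suff : dt (last x s) + (size s).+1%:Z <= dt (sh n l (g 0)) by lia.
    apply: h; first by rewrite gsh.
    split=> //=; last by rewrite hl.
    by move=> y; rewrite inE => /orP[/eqP ->|/sB].
  exists t; split=> // s ps; apply: tmax; by exists s.
have [d hd] : exists d : cell -> int, forall x, B x -> dval B C dt x (d x).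
  exists (fun x => epsilon (inhabits 0) (dval B C dt x)) => x /ex.
  exact: epsilon_spec.
have dge x s : B x -> dpath B C x s -> dt (last x s) + (size s)%:Z <= d x.
  by move=> Bx; have [_] := hd x Bx; apply.
have dsh x (k : int) : B x -> d x + k * m <= d (sh n k x).
  move=> Bx; have [[s [[sB sp /CgP[i ei]] <-]] _] := hd x Bx.
  have := dge (sh n k x) (map (sh n k) s) (BS _ _ Bx).
  rewrite last_map size_map ei gsh !dg => h.
  suff : i + k * m + (size s)%:Z <= d (sh n k x) by lia.
  apply: h; split.
  - by move=> y /mapP[z /sB Bz ->]; apply: BS.
  - by rewrite path_map; apply: sub_path sp => y z; rewrite /= snwb_sh.
  - by rewrite last_map ei gsh.
have dlt x y : B x -> B y -> snwb x y -> d x < d y.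
  move=> Bx By xy; have [[s [[sB sp sC] e]] _] := hd x Bx.
  have := dge y (x :: s) By; rewrite /= => h.
  suff : dt (last x s) + (size s).+1%:Z <= d y by lia.
  apply: h; split=> //=; last by rewrite xy.
  by move=> z; rewrite inE => /orP[/eqP ->|/sB].
exists d, m; split=> //.
  move=> x k Bx; apply/eqP; rewrite eq_le dsh // andbT.
  have := dsh (sh n k x) (- k) (BS _ _ Bx).
  by rewrite shK mulNr; lia.
(* Either an optimal path is empty, so that [x] is on the channel and its channel predecessor
   serves, or its first step leads to the ball sought. *)
move=> x Bx; have [[[|y s] [[sB sp sC] e]] _] := hd x Bx.
  have /CgP[i /= ei] := sC; move: e; rewrite /= addr0 {1}ei dg => e.
  have hx : snwb (g (i - 1)) x by have := gS (i - 1); rewrite subrK -ei.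
  exists (g (i - 1)); split=> //.
  have := dlt _ _ (gB _) Bx hx.
  have := dge (g (i - 1)) [::] (gB _); rewrite /= dg addr0 => h.
  have : i - 1 <= d (g (i - 1)) by apply: h; split=> //; apply/CgP; exists (i - 1).
  lia.
have By : B y by apply: sB; rewrite mem_head.
move: sp => /= /andP[yx sp].
exists y; split=> //.
have := dlt _ _ By Bx yx; have := dge y s By.
move: e; rewrite /= => e h.
have : dt (last y s) + (size s)%:Z <= d y.
  by apply: h; split=> // z zs; apply: sB; rewrite inE zs orbT.
lia.
Qed.
End Distance.

(** * Zigzags *)

Definition rres (n : nat) (s : seq cell) : seq nat := [seq resid n x.1 | x <- s].
Definition cres (n : nat) (s : seq cell) : seq nat := [seq resid n x.2 | x <- s].

Definition ceilsum (n : nat) (s : seq cell) : int :=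
  \sum_(c <- s) (ceilz n c.2 - ceilz n c.1).

(* For representatives of the balls of an affine permutation [w], with [w i = sigma i + n a_i]
   on [1..n], this is the parity of [inv sigma + \sum_i a_i]. *)
Definition chi (n : nat) (s : seq cell) : bool :=
  odd (ninv (rres n s)) (+) odd (ninv (cres n s)) (+) odd `|ceilsum n s|%N.

(** Distinct residues give one ball per translation class and also encode that no two balls of [B]
    share a row or a column. *)
Definition reps (n : nat) (B : cellset) (s : seq cell) : Prop :=
  [/\ forall x, B x <-> exists2 y, y \in s & exists k : int, x = sh n k y,
      uniq (rres n s) & uniq (cres n s)].

Lemma uniq_map_inj_in (T U : eqType) (f : T -> U) (s : seq T) :
  uniq (map f s) -> {in s &, injective f}.
Proof.
elim: s => //= x s IH /andP[nx /IH fi] a b.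
rewrite !inE => /orP[/eqP->|sa] /orP[/eqP->|sb] // e; last exact: fi.
  by case/negP: nx; rewrite e map_f.
by case/negP: nx; rewrite -e map_f.
Qed.

Section Residues.
Variable n : nat.
Hypothesis n0 : (0 < n)%N.

Lemma resid_sh1 k x : resid n (sh n k x).1 = resid n x.1.
Proof. by case: (ceilz_resid_shift n x.1 k n0). Qed.

Lemma resid_sh2 k x : resid n (sh n k x).2 = resid n x.2.
Proof. by case: (ceilz_resid_shift n x.2 k n0). Qed.

Lemma ceilz_sh1 k x : ceilz n (sh n k x).1 = ceilz n x.1 + k.
Proof. by case: (ceilz_resid_shift n x.1 k n0). Qed.

Lemma ceilz_sh2 k x : ceilz n (sh n k x).2 = ceilz n x.2 + k.
Proof. by case: (ceilz_resid_shift n x.2 k n0). Qed.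

Lemma resid_eq_shift (a b : int) : resid n a = resid n b ->
  a = b + (ceilz n a - ceilz n b) * n%:Z.
Proof.
move=> e; have [ea _] := resid_ceilzP n a n0; have [eb _] := resid_ceilzP n b n0.
rewrite {1}ea {1}eb e !mulrBl; lia.
Qed.

Lemma chi_shift (f : cell -> int) s : chi n [seq sh n (f x) x | x <- s] = chi n s.
Proof.
rewrite /chi /ceilsum big_map.
have -> : rres n [seq sh n (f x) x | x <- s] = rres n s.
  by rewrite /rres -map_comp; apply: eq_map => x; exact: resid_sh1.
have -> : cres n [seq sh n (f x) x | x <- s] = cres n s.
  by rewrite /cres -map_comp; apply: eq_map => x; exact: resid_sh2.
congr (_ (+) odd (absz _)); apply: eq_bigr => x _.
by rewrite ceilz_sh1 ceilz_sh2; lia.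
Qed.

Lemma chi_perm s t : perm_eq s t -> uniq (rres n s) -> uniq (cres n s) -> chi n s = chi n t.
Proof.
move=> pst ur uc; rewrite /chi (odd_ninv_perm _ _ _ _ _ pst ur uc).
by rewrite /ceilsum (perm_big _ pst).
Qed.

(** Translating every representative into rows [1] to [n] changes neither residues nor [chi], and
    makes the two lists permutations of each other. *)
Lemma reps_perm_chi B s t : reps n B s -> reps n B t ->
  [/\ chi n s = chi n t, perm_eq (rres n s) (rres n t) & perm_eq (cres n s) (cres n t)].
Proof.
move=> [Bs urs ucs] [Bt urt uct].
pose norm x := sh n (1 - ceilz n x.1) x.
have normK k x : norm (sh n k x) = norm x.
  by rewrite /norm ceilz_sh1 shD; congr sh; lia.
have nr s' : rres n (map norm s') = rres n s'.
  by rewrite /rres -map_comp; apply: eq_map => x; exact: resid_sh1.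
have nc s' : cres n (map norm s') = cres n s'.
  by rewrite /cres -map_comp; apply: eq_map => x; exact: resid_sh2.
have sub s1 s2 : (forall x, B x <-> exists2 y, y \in s1 & exists k : int, x = sh n k y) ->
    (forall x, B x <-> exists2 y, y \in s2 & exists k : int, x = sh n k y) ->
    {subset map norm s1 <= map norm s2}.
  move=> B1 B2 _ /mapP[y ys ->].
  have /B2[z zs [k ->]] : B y by apply/B1; exists y => //; exists 0; rewrite sh0.
  by rewrite normK; apply: map_f.
have uni s' : uniq (rres n s') -> uniq (map norm s').
  by rewrite -nr => /map_uniq.
have p : perm_eq (map norm s) (map norm t).
  apply: uniq_perm; [exact: uni | exact: uni |] => x.
  by apply/idP/idP; apply: sub.
split.
- rewrite -(chi_shift (fun x => 1 - ceilz n x.1) s) -(chi_shift (fun x => 1 - ceilz n x.1) t).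
  by apply: chi_perm; rewrite -/norm ?nr ?nc.
- by rewrite -nr -(nr t); apply: perm_map.
- by rewrite -nc -(nc t); apply: perm_map.
Qed.

Lemma reps_mem B s x : reps n B s -> x \in s -> B x.
Proof. by move=> [hB _ _] xs; apply/hB; exists x => //; exists 0; rewrite sh0. Qed.

Lemma reps_trinv B s : reps n B s -> trinv n B.
Proof.
move=> [hB _ _] x; rewrite (_ : (_, _) = sh n 1 x); last by rewrite /sh mul1r.
split=> /hB[y ys [k e]]; apply/hB; exists y => //.
  by exists (1 + k); rewrite e shD.
by exists (-1 + k); rewrite -shD -e shD addNr sh0.
Qed.

Lemma reps_row B s a b : reps n B s -> B a -> B b -> a.1 = b.1 -> a = b.
Proof.
move=> [hB ur _] /hB[y ys [k ->]] /hB[z zs [l ->]] e.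
have yz : y = z.
  by apply: (uniq_map_inj_in _ _ _ _ ur) => //; rewrite -(resid_sh1 k) e resid_sh1.
by subst z; have := ceilz_sh1 k y; rewrite e ceilz_sh1 => h; congr sh; lia.
Qed.

Lemma reps_col B s a b : reps n B s -> B a -> B b -> a.2 = b.2 -> a = b.
Proof.
move=> [hB _ uc] /hB[y ys [k ->]] /hB[z zs [l ->]] e.
have yz : y = z.
  by apply: (uniq_map_inj_in _ _ _ _ uc) => //; rewrite -(resid_sh2 k) e resid_sh2.
by subst z; have := ceilz_sh2 k y; rewrite e ceilz_sh2 => h; congr sh; lia.
Qed.
End Residues.

(** * Corners of a level listed by increasing row *)

Fixpoint outer_from (x : cell) (s : seq cell) : seq cell :=
  if s is y :: s' then (y.1, x.2) :: outer_from y s' else [::].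

Definition outer (s : seq cell) : seq cell :=
  if s is x :: s' then outer_from x s' else [::].

Definition back (s : seq cell) : cell := ((head (0, 0) s).1, (last (0, 0) s).2).

(** With the back corner first, the rows keep the order of [s] and the columns are rotated right by
    one. *)
Definition zigzag (s : seq cell) : seq cell :=
  if s is x :: s' then back s :: outer s else [::].

Lemma outer_from_fst x s : map fst (outer_from x s) = map fst s.
Proof. by elim: s x => //= y s IH x; rewrite IH. Qed.

Lemma outer_from_snd x s : map snd (outer_from x s) = map snd (belast x s).
Proof. by elim: s x => //= y s IH x; rewrite IH. Qed.

Lemma zigzag_fst s : map fst (zigzag s) = map fst s.
Proof. by case: s => //= x s; rewrite outer_from_fst. Qed.

Lemma zigzag_snd s : map snd (zigzag s) = rotr 1 (map snd s).
Proof.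
case: s => // x s; rewrite [x :: s in RHS]lastI map_rcons rotr1_rcons /=.
by rewrite outer_from_snd.
Qed.

Lemma size_outer s : size (outer s) = (size s).-1.
Proof. by case: s => //= x s; rewrite -(size_map fst) outer_from_fst size_map. Qed.

Lemma flatten_rotr_perm (A : seq (seq nat)) :
  perm_eq (flatten [seq rotr 1 a | a <- A]) (flatten A).
Proof. by elim: A => //= a A IH; apply: perm_cat => //; rewrite perm_rotr. Qed.

(** Rotating a block moves one entry past all others of that block; inversions between blocks depend
    only on their contents. *)
Lemma odd_ninv_rotr (A : seq (seq nat)) : uniq (flatten A) ->
  odd (ninv (flatten [seq rotr 1 a | a <- A])) =
  odd (ninv (flatten A)) (+) odd (\sum_(a <- A) (size a).-1).
Proof.
elim: A => [|a A IH] /=; first by rewrite big_nil.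
rewrite cat_uniq => /and3P[ua _ /IH e]; rewrite big_cons (ninv_cat (rotr 1 a)) (ninv_cat a).
have -> : cross (rotr 1 a) (flatten [seq rotr 1 a0 | a0 <- A]) = cross a (flatten A).
  by apply: cross_perm; rewrite ?perm_rotr // flatten_rotr_perm.
rewrite !oddD.
have -> : odd (ninv (rotr 1 a)) = odd (ninv a) (+) odd (size a).-1.
  case/lastP: a ua => // s x us; rewrite rotr1_rcons size_rcons odd_ninv_rcons.
    by rewrite -addbA addbb addbF.
  by move: us; rewrite rcons_uniq.
rewrite e; move: (odd _) (odd _) (odd _) (odd _) (odd _) => b1 b2 b3 b4 b5.
by case: b1; case: b2; case: b3; case: b4; case: b5.
Qed.

Lemma ceilsumE n s :
  ceilsum n s = \sum_(c <- map snd s) ceilz n c - \sum_(c <- map fst s) ceilz n c.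
Proof. by rewrite /ceilsum sumrB !big_map. Qed.

Lemma rresE n s : rres n s = map (resid n) (map fst s).
Proof. by rewrite -map_comp. Qed.

Lemma cresE n s : cres n s = map (resid n) (map snd s).
Proof. by rewrite -map_comp. Qed.

(** Rows stay in place and columns only move within levels, so [ceilsum] is unchanged and the column
    inversions alone contribute. *)
Lemma chi_zigzag n (A : seq (seq cell)) : uniq (cres n (flatten A)) ->
  [/\ chi n (flatten A) = chi n (flatten (map zigzag A)) (+) odd (size (flatten (map outer A))),
      perm_eq (rres n (flatten A)) (rres n (flatten (map zigzag A))) &
      perm_eq (cres n (flatten A)) (cres n (flatten (map zigzag A)))].
Proof.
move=> uc.
have es : map snd (flatten (map zigzag A)) = flatten (map (rotr 1) (map (map snd) A)).
  by rewrite map_flatten -!map_comp; congr flatten; apply: eq_map => s /=; apply: zigzag_snd.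
have ef : map fst (flatten (map zigzag A)) = map fst (flatten A).
  by rewrite !map_flatten -!map_comp; congr flatten; apply: eq_map => s /=; apply: zigzag_fst.
have er : rres n (flatten (map zigzag A)) = rres n (flatten A) by rewrite !rresE ef.
have ec : cres n (flatten (map zigzag A)) = flatten (map (rotr 1) (map (cres n) A)).
  rewrite cresE es map_flatten -!map_comp; congr flatten; apply: eq_map => s /=.
  by rewrite map_rotr cresE.
have ec0 : cres n (flatten A) = flatten (map (cres n) A) by rewrite /cres map_flatten.
have ps : perm_eq (map snd (flatten (map zigzag A))) (map snd (flatten A)).
  rewrite es map_flatten; elim: (map _ A) => //= a l IH.
  by apply: perm_cat => //; rewrite perm_rotr.
split; last 2 first.
- by rewrite er.
- by rewrite ec ec0 perm_sym flatten_rotr_perm.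
rewrite /chi !ceilsumE ef (perm_big _ ps) /= er ec odd_ninv_rotr -?ec0 //.
have -> : (\sum_(a <- map (cres n) A) (size a).-1)%N = size (flatten (map outer A)).
  rewrite size_flatten /shape -map_comp sumnE !big_map; apply: eq_bigr => a _.
  by rewrite size_map /= size_outer.
by move: (odd _) (odd _) (odd _) (odd _) => [] [] [] [].
Qed.

Lemma zigzag_perm (A : seq (seq cell)) : all (fun s => 0 < size s)%N A ->
  perm_eq (flatten (map zigzag A)) (map back A ++ flatten (map outer A)).
Proof.
elim: A => //= a A IH /andP[a0 /IH p].
case: a a0 => // x s _; rewrite /= perm_cons /=.
rewrite perm_sym perm_catCA perm_sym; exact: perm_cat.
Qed.

Lemma outer_corner_sorted (L : cellset) s c :
  (forall x, L x <-> x \in s) -> sorted (fun a b : cell => a.1 < b.1) s ->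
  outer_corner L c <-> c \in outer s.
Proof.
move=> hL; rewrite /outer_corner.
have -> : (exists a b, [/\ L a, L b, a.1 < b.1,
    (forall c, L c -> ~ (a.1 < c.1 /\ c.1 < b.1)) & c = (b.1, a.2)]) <->
  (exists a b : cell, [/\ a \in s, b \in s, a.1 < b.1,
    (forall c : cell, c \in s -> ~ (a.1 < c.1 /\ c.1 < b.1)) & c = (b.1, a.2)]).
  by split=> -[a [b [/hL h1 /hL h2 h3 h4 h5]]]; exists a, b; split=> // z /hL; apply: h4.
have tr : transitive (fun a b : cell => a.1 < b.1) by move=> y x z; apply: lt_trans.
case: s {hL} => [|x s] /=; first by split=> // -[a [b []]].
elim: s x => [|y s IH] x /=.
  move=> _; split=> // -[a [b [+ + ab _ _]]].
  by rewrite !inE => /eqP ea /eqP eb; move: ab; rewrite ea eb ltxx.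
move=> /andP[xy ys].
have ymin z : z \in y :: s -> y.1 <= z.1.
  rewrite inE => /orP[/eqP->//|zs]; apply: ltW.
  by have /allP := order_path_min tr ys; apply.
rewrite inE -(rwP orP) -(rwP eqP) -(IH y ys); split.
  move=> [a [b [ia ib ab nb ->]]].
  have nax : b \in y :: s.
    move: ib; rewrite in_cons => /orP[/eqP eb|//].
    move: ia ab; rewrite in_cons eb => /orP[/eqP->|/ymin]; first by rewrite ltxx.
    by move=> h ax; have := lt_trans (le_lt_trans h ax) xy; rewrite ltxx.
  move: ia; rewrite in_cons => /orP[/eqP ea|ia]; last first.
    right; exists a, b; split=> // z zs; apply: nb; rewrite in_cons zs orbT //.
  left; subst a; congr pair; apply/eqP; rewrite eq_le (ymin _ nax) andbT leNgt.
  by apply/negP => yb; apply: (nb y); rewrite ?inE ?eqxx ?orbT.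
case=> [->|[a [b [ia ib ab nb ->]]]].
  exists x, y; split; rewrite ?inE ?eqxx ?orbT // => z.
  rewrite in_cons => /orP[/eqP->|/ymin h] []; first by rewrite ltxx.
  by move=> _; rewrite ltNge h.
exists a, b; split=> //; rewrite ?[_ \in x :: _]in_cons ?ia ?ib ?orbT //.
move=> z; rewrite in_cons => /orP[/eqP->|/nb//] [ax _].
by move: (ymin _ ia); rewrite leNgt (lt_trans ax xy).
Qed.

Lemma back_corner_sorted (L : cellset) s c : s != [::] ->
  (forall x, L x <-> x \in s) -> sorted (fun a b : cell => a.1 < b.1) s ->
  back_corner L c <-> c = back s.
Proof.
move=> s0 hL ss.
have tr : transitive (fun a b : cell => a.1 < b.1) by move=> y x z; apply: lt_trans.
have hmin z : z \in s -> (head (0, 0) s).1 <= z.1.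
  case: s ss {s0 hL} => //= x s xs; rewrite inE => /orP[/eqP->//|zs]; apply: ltW.
  by have /allP := order_path_min tr xs; apply.
have hmax z : z \in s -> z.1 <= (last (0, 0) s).1 ?= iff (z == last (0, 0) s).
  case/lastP: s ss {s0 hL hmin} => // s x xs; rewrite last_rcons mem_rcons inE.
  case: eqP => [-> _|ne /= zs]; first exact: leif_refl.
  suff h : z.1 < x.1 by split; [exact: ltW | rewrite lt_eqF].
  by move: xs; rewrite (sorted_pairwise tr) pairwise_rcons => /andP[/allP/(_ z zs)].
have hh : head (0, 0) s \in s by case: (s) s0 => // x s'; rewrite mem_head.
have hl : last (0, 0) s \in s by case: (s) s0 => // x s' _; rewrite /= mem_last.
split=> [[a [b [/hL ia /hL ib amin bmax ->]]]|->].
  rewrite /back; congr pair.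
    by apply/eqP; rewrite eq_le hmin // amin //; apply/hL.
  congr snd; apply/eqP; rewrite -(hmax _ ib).2 eq_le (hmax _ ib).1 bmax //; exact/hL.
exists (head (0, 0) s), (last (0, 0) s); split=> //; try exact/hL.
  by move=> z /hL; apply: hmin.
by move=> z /hL/hmax[].
Qed.

Lemma uniq_flatten_fibers (T I : eqType) (L : I -> seq T) (d : T -> I) (ts : seq I) :
  uniq ts -> (forall t, uniq (L t)) ->
  (forall t x, t \in ts -> x \in L t -> d x = t) -> uniq (flatten (map L ts)).
Proof.
move=> + uL; elim: ts => //= t ts IH /andP[nt uts] dL.
rewrite cat_uniq uL IH //; last by move=> t' x t's; apply: dL; rewrite inE t's orbT.
rewrite andbT; apply/hasPn => x /flatten_mapP[t' t's xt'].
apply/negP => /dL -/(_ (mem_head _ _)) e; case/negP: nt.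
by rewrite -e (dL t' x) // inE t's orbT.
Qed.

Lemma segment_cover (m t t0 : int) : 0 < m -> exists k : int, t0 < t + k * m <= t0 + m.
Proof.
move=> m0; have e := divz_eq (t - t0 - 1) m.
have h : 0 <= ((t - t0 - 1) %% m)%Z by rewrite modz_ge0 //; lia.
have h' := ltz_pmod (t - t0 - 1) m0.
by exists (- ((t - t0 - 1) %/ m)%Z); rewrite mulNr; lia.
Qed.

(** * One step of AMBC *)

Section Step.
Variables (n : nat) (B : cellset) (s : seq cell).
Hypotheses (n0 : (0 < n)%N) (Bs : reps n B s).
Variables (d : cell -> int) (m : int).
Hypothesis m0 : 0 < m.
Hypothesis dsh : forall x (k : int), B x -> d (sh n k x) = d x + k * m.
Hypothesis dlt : forall x y, B x -> B y -> snwb x y -> d x < d y.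
Hypothesis dpred : forall x, B x -> exists y, [/\ B y, snwb y x & d y = d x - 1].
Hypothesis Bex : exists x, B x.

Let rlt (a b : cell) := a.1 < b.1.

Let BS : forall k x, B x -> B (sh n k x).
Proof. exact: trinv_sh (reps_trinv n B s Bs). Qed.

(** Translation raises [d] by [m], so a representative [y] has at most one translate in level [t],
    the one by [(t - d y) / m]. Levels are therefore finite. *)
Lemma levels_exist : exists L : int -> seq cell,
  forall t, sorted rlt (L t) /\ forall x, x \in L t <-> B x /\ d x = t.
Proof.
pose M t := [seq sh n ((t - d y) %/ m)%Z y | y <- s & (m %| t - d y)%Z].
exists (fun t => sort (fun a b : cell => a.1 <= b.1) (M t)) => t; split.
  have -> l : sorted rlt l = sorted <%R (map fst l) by rewrite sorted_map.
  rewrite lt_sorted_uniq_le; apply/andP; split.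
    rewrite (perm_uniq (perm_map fst (permEl (perm_sort _ _)))).
    apply: (@map_uniq _ _ (resid n)); rewrite -rresE /rres -map_comp.
    rewrite (eq_map (g := fun x : cell => resid n x.1)); last by move=> x; exact: resid_sh1.
    case: Bs => _ ur _; apply: subseq_uniq ur; apply: map_subseq; exact: filter_subseq.
  by rewrite sorted_map; apply: sort_sorted => a b; exact: le_total.
move=> x; rewrite mem_sort; split.
  move=> /mapP[y]; rewrite mem_filter => /andP[mt ys] ->.
  have By := reps_mem n B s y Bs ys.
  by split; [exact: BS | rewrite dsh // divzK //; lia].
move=> [Bx <-]; have [hB _ _] := Bs.
have [y ys [k ek]] := (hB x).1 Bx.
have By := reps_mem n B s y Bs ys.
have e : d x - d y = k * m by rewrite ek dsh //; lia.
apply/mapP; exists y; first by rewrite mem_filter ys andbT e dvdz_mull.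
by rewrite e mulzK //; lia.
Qed.

Variable L : int -> seq cell.
Hypothesis Lsort : forall t, sorted rlt (L t).
Hypothesis Lmem : forall t x, x \in L t <-> B x /\ d x = t.

Let rtr : transitive rlt.
Proof. by move=> y x z; apply: lt_trans. Qed.

Let rirr : irreflexive rlt.
Proof. by move=> x; rewrite /rlt ltxx. Qed.

Lemma levels_shift (t k : int) : L (t + k * m) = map (sh n k) (L t).
Proof.
apply: (irr_sorted_eq rtr rirr) => //.
  by rewrite sorted_map; apply: sub_sorted (Lsort t) => a b; rewrite /rlt /= ltrD2r.
move=> x; apply/idP/mapP => [/Lmem[Bx dx]|[y /Lmem[By <-] ->]].
  exists (sh n (- k) x); last by rewrite shD addrN sh0.
  by apply/Lmem; split; [exact: BS | rewrite dsh // dx; lia].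
by apply/Lmem; split; [exact: BS | rewrite dsh].
Qed.

(** Translations reach values of [d] above [t], and predecessors descend from there one unit at a
    time. *)
Lemma levels_neq0 t : L t != [::].
Proof.
have down (k : nat) (x : cell) : B x -> exists2 y, B y & d y = d x - k%:Z.
  move=> Bx; elim: k => [|k [y By e]]; first by exists x => //; rewrite subr0.
  by have [z [Bz _ ez]] := dpred y By; exists z => //; lia.
have [x Bx] := Bex.
have [k hk] : exists k : int, 0 <= d x + k * m - t.
  have [c hc] : exists c : nat, t - d x <= c%:Z by exists `|t - d x|%N; lia.
  exists c%:Z; have : 0 <= c%:Z * (m - 1) by apply: mulr_ge0; lia.
  rewrite mulrBr mulr1; lia.
have [y By ey] := down `|(d x + k * m)%R - t|%N (sh n k x) (BS k x Bx).
have : y \in L t by apply/Lmem; split=> //; rewrite ey dsh //; lia.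
by case: (L t).
Qed.

Lemma level_row_min t x : x \in L t -> (back (L t)).1 <= x.1.
Proof.
move: (Lsort t); rewrite /back; case: (L t) => //= a l al.
rewrite inE => /orP[/eqP->//|xl]; apply: ltW.
by have /allP := order_path_min rtr al; apply.
Qed.

(* Balls of one level are pairwise incomparable, so the lowest one is also the leftmost one. *)
Lemma level_col_min t x : x \in L t -> (back (L t)).2 <= x.2.
Proof.
move=> xt.
have lt : last (0, 0) (L t) \in L t.
  by move: (levels_neq0 t); case: (L t) => // a l _; rewrite /= mem_last.
rewrite /back leNgt; apply/negP => /= h.
have /Lmem[Bl dl] := lt; have /Lmem[Bx dx] := xt.
have hr : x.1 < (last (0, 0) (L t)).1.
  move: xt (Lsort t) h {lt dl Bl}; case/lastP: (L t) => // l a.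
  rewrite last_rcons mem_rcons inE => /orP[/eqP->|xl]; first by rewrite ltxx.
  by rewrite (sorted_pairwise rtr) pairwise_rcons => /andP[/allP/(_ x xl)].
have := dlt x (last (0, 0) (L t)) Bx Bl; rewrite /snwb hr h => /(_ isT).
by rewrite dx dl ltxx.
Qed.

(** Every ball of level [t + 1] has one of level [t] strictly northwest of it, and a back corner
    takes the least row and the least column of its level. *)
Lemma back_pchain (S : cellset) : (forall x, S x <-> exists t : int, x = back (L t)) ->
  pchain n S (fun t => back (L t)) m 1.
Proof.
move=> hS; split=> t; first by apply/hS; exists t.
  have [hh hl] : head (0, 0) (L (t + 1)) \in L (t + 1) /\ last (0, 0) (L (t + 1)) \in L (t + 1).
    by move: (levels_neq0 (t + 1)); case: (L (t + 1)) => // a l _; rewrite /= mem_last mem_head.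
  have step x : x \in L (t + 1) -> exists2 y, y \in L t & snwb y x.
    move=> /Lmem[Bx dx]; have [y [By yx dy]] := dpred x Bx.
    by exists y => //; apply/Lmem; split=> //; rewrite dy dx addrK.
  have [y yt /andP[yh _]] := step _ hh; have [z zt /andP[_ zl]] := step _ hl.
  by rewrite /snwb (le_lt_trans (level_row_min _ _ yt) yh) (le_lt_trans (level_col_min _ _ zt) zl).
rewrite -[in LHS](mul1r m) levels_shift /back.
by case: (L t) (levels_neq0 t) => // a l _; rewrite /= last_map.
Qed.

Lemma outer_shift (k : int) l : outer (map (sh n k) l) = map (sh n k) (outer l).
Proof. by case: l => //= a l; elim: l a => //= b l IH a; rewrite IH. Qed.

Variable t0 : int.
Let ts : seq int := segment id t0 `|m|%N.

Let tsP t : reflect (t0 < t <= t0 + m) (t \in ts).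
Proof.
apply: (iffP (segmentP _ _ _ _ _)) => [[i + ->]|h]; first lia.
by exists t => //; lia.
Qed.

(** Translation moves a ball by [m] levels, so [m] consecutive levels meet each class exactly
    once. *)
Lemma levels_reps : reps n B (flatten (map L ts)).
Proof.
have inj x y (k : int) : x \in flatten (map L ts) -> y \in flatten (map L ts) -> y = sh n k x -> x = y.
  move=> /flatten_mapP[t /tsP ht /Lmem[Bx dx]] /flatten_mapP[t' /tsP ht' /Lmem[By dy]] e.
  suff k0 : k = 0 by rewrite e k0 sh0.
  have : t' = t + k * m by rewrite -dy e dsh // dx.
  case: (ltgtP k 0) => // hk.
    by have : 0 <= (- k - 1) * m by [apply: mulr_ge0; lia]; rewrite mulrBl mulNr; lia.
  by have : 0 <= (k - 1) * m by [apply: mulr_ge0; lia]; rewrite mulrBl; lia.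
have FB x : x \in flatten (map L ts) -> B x by move=> /flatten_mapP[t _ /Lmem[]].
have uF : uniq (flatten (map L ts)).
  apply: (@uniq_flatten_fibers _ _ L d).
  - by rewrite map_inj_uniq ?iota_uniq // => i j; lia.
  - by move=> t; apply: sorted_uniq (Lsort t).
  - by move=> t x _ /Lmem[].
split.
- move=> x; split=> [Bx|[y /FB By [k ->]]]; last exact: BS.
  have [k hk] := segment_cover m (d x) t0 m0.
  exists (sh n k x); last by exists (- k); rewrite shK.
  apply/flatten_mapP; exists (d x + k * m); first exact/tsP.
  by apply/Lmem; split; [exact: BS | rewrite dsh].
- rewrite map_inj_in_uniq // => x y xF yF e.
  apply: (inj x y (ceilz n y.1 - ceilz n x.1)) => //.
  apply: (reps_row n n0 B s) => //; [exact: FB | exact/BS/FB |].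
  by rewrite /sh /=; apply: resid_eq_shift.
- rewrite map_inj_in_uniq // => x y xF yF e.
  apply: (inj x y (ceilz n y.2 - ceilz n x.2)) => //.
  apply: (reps_col n n0 B s) => //; [exact: FB | exact/BS/FB |].
  by rewrite /sh /=; apply: resid_eq_shift.
Qed.

Lemma zigzag_split (B' : cellset) :
  (forall x, B' x <-> exists t : int, x \in outer (L t)) ->
  exists s', let sS := segment (fun t => back (L t)) t0 `|m|%N in
  [/\ reps n B' s', perm_eq (rres n s) (rres n (sS ++ s')),
      perm_eq (cres n s) (cres n (sS ++ s')) &
      chi n s = chi n (sS ++ s') (+) odd (size s')].
Proof.
move=> hB'; exists (flatten (map outer (map L ts))) => sS.
have sSE : sS = map back (map L ts) by rewrite /sS /ts /segment -!map_comp.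
have FR := levels_reps; have [_ urF ucF] := FR.
have [e1 pr1 pc1] := reps_perm_chi n n0 B s _ Bs FR.
have [e2 pr2 pc2] := chi_zigzag n _ ucF.
have pz : perm_eq (flatten (map zigzag (map L ts))) (sS ++ flatten (map outer (map L ts))).
  rewrite sSE; apply: zigzag_perm; apply/allP => l /mapP[t _ ->].
  by rewrite lt0n size_eq0 levels_neq0.
have pr : perm_eq (rres n s) (rres n (sS ++ flatten (map outer (map L ts)))).
  by rewrite (perm_trans pr1) // (perm_trans pr2) //; apply: perm_map.
have pc : perm_eq (cres n s) (cres n (sS ++ flatten (map outer (map L ts)))).
  by rewrite (perm_trans pc1) // (perm_trans pc2) //; apply: perm_map.
split=> //; last first.
  rewrite e1 e2; congr addb; apply: chi_perm => //.
    by rewrite -(perm_uniq pr2).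
  by rewrite -(perm_uniq pc2).
have [_ urs ucs] := Bs; split.
- move=> x; split=> [/hB'[t xt]|[y /flatten_mapP[_ /mapP[t _ ->] yt] [k ->]]].
    have [k hk] := segment_cover m t t0 m0.
    exists (sh n k x); last by exists (- k); rewrite shK.
    apply/flatten_mapP; exists (L (t + k * m)); first by apply: map_f; apply/tsP.
    by rewrite levels_shift outer_shift; apply: map_f.
  by apply/hB'; exists (t + k * m); rewrite levels_shift outer_shift; apply: map_f.
- by move: urs; rewrite (perm_uniq pr) /rres map_cat cat_uniq => /and3P[].
- by move: ucs; rewrite (perm_uniq pc) /cres map_cat cat_uniq => /and3P[].
Qed.
End Step.

Lemma ambc_step_split (n : nat) (B B' S : cellset) (s : seq cell) :
  (0 < n)%N -> reps n B s -> ambc_step n B B' S ->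
  exists (g : int -> cell) (m : nat) (t0 : int) (s' : seq cell),
  let sS := segment g t0 m in
  [/\ pchain n S g m%:Z 1, forall x, S x <-> exists t : int, x = g t,
      forall i, (1 <= (g i).1 <= n%:Z) = (t0 < i <= t0 + m%:Z) &
  [/\ reps n B' s', perm_eq (rres n s) (rres n (sS ++ s')),
      perm_eq (cres n s) (cres n (sS ++ s')) &
      chi n s = chi n (sS ++ s') (+) odd (size s')]].
Proof.
move=> n0 Bs [C [dt [chC _ numC hB' hS]]].
have BT := reps_trinv n B s Bs.
have Bex : exists x, B x.
  by have [_ /(_ 0)[c [Cc _]]] := numC; exists c; have [[CB _ _] _] := chC; apply: CB.
have [d [m [m0 dv dsh dlt dpred]]] := distance_exists n B n0 BT
  (fun a b => reps_row n n0 B s a b Bs) (fun a b => reps_col n n0 B s a b Bs) C dt chC numC.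
have [L hL] := levels_exist n B s n0 Bs d m m0 dsh.
have Lsort t := (hL t).1; have Lmem t := (hL t).2.
have lev t x : level B C dt t x <-> x \in L t.
  rewrite Lmem /level; split=> -[Bx h]; split=> //; last by rewrite -h; apply: dv.
  (* Two values of [dval] agree: each is attained by a path and bounded by the other. *)
  have [[p [pp ep]] h1] := h; have [[q [qq eq]] h2] := dv x Bx.
  by apply/eqP; rewrite eq_le -{1}eq -{2}ep h1 // h2.
have L0 := levels_neq0 n B s n0 Bs d m m0 dsh dpred Bex L Lmem.
have hS' x : S x <-> exists t : int, x = back (L t).
  by rewrite hS; split=> -[t h]; exists t; move: h;
    rewrite (back_corner_sorted _ _ _ (L0 t) (lev t) (Lsort t)).
have hB'' x : B' x <-> exists t : int, x \in outer (L t).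
  by rewrite hB'; split=> -[t h]; exists t; move: h;
    rewrite (outer_corner_sorted _ _ _ (lev t) (Lsort t)).
have pS := back_pchain n B s n0 Bs d m m0 dsh dlt dpred Bex L Lsort Lmem S hS'.
(* The window of levels is chosen so that its back corners are those in rows [1] to [n], the
   representatives summed in [rec_rho]. *)
have [t0 ht] := pchain_window n S n0 _ _ pS.
have [s' hs'] := zigzag_split n B s n0 Bs d m m0 dsh dpred Bex L Lsort Lmem t0 B' hB''.
exists (fun t => back (L t)), `|m|%N, t0, s'.
rewrite (_ : `|m|%N%:Z = m); last lia.
by split.
Qed.

(** * The induction over AMBC *)

(** Shi's formula for the affine length without its absolute values, which do not affect parity. *)
Fixpoint fsum (n : nat) (s : seq int) : int :=
  if s is x :: s' then \sum_(y <- s') ((y - x) %/ n%:Z)%Z + fsum n s' else 0.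

Lemma divz_sub_resid (n : nat) (x y : int) : (0 < n)%N ->
  ((y - x) %/ n%:Z)%Z = ceilz n y - ceilz n x - (resid n y < resid n x)%N%:Z.
Proof.
move=> n0; have [ex rx] := resid_ceilzP n x n0; have [ey ry] := resid_ceilzP n y n0.
have e := divz_eq (y - x) n%:Z.
have h := modz_ge0 (y - x) (_ : n%:Z != 0); have {}h := h ltac:(lia).
have h' := ltz_pmod (y - x) (_ : 0 < n%:Z); have {}h' := h' ltac:(lia).
move: (divz _ _) (modz _ _) e h h' => q r e h h'.
have [b hb] : exists b : int, b = (resid n y < resid n x)%N%:Z by eexists.
have bn : b * n%:Z = if (resid n y < resid n x)%N then n%:Z else 0.
  by rewrite hb; case: ltnP => _; rewrite ?mul1r ?mul0r.
(* [b] is the borrow in subtracting the residues. Both remainders are raised by one to fit the range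
   of [euclid_uniq]. *)
rewrite -hb; have [] // : q = ceilz n y - ceilz n x - b /\
  r + 1 = (resid n y)%:Z - (resid n x)%:Z + b * n%:Z + 1.
apply: (@euclid_uniq n%:Z); last by rewrite bn; case: ltnP; lia.
  by rewrite addrA -e {1}ex {1}ey !mulrBl; lia.
lia.
Qed.

Lemma odd_abszD (x y : int) : odd `|(x + y)%R|%N = odd `|x|%N (+) odd `|y|%N.
Proof. lia. Qed.

(** Each ceiling occurs, up to sign, once for every other entry, hence the factor [size s - 1]; the
    borrows count the inversions of the residues. *)
Lemma fsum_parity (n : nat) (s : seq int) : (0 < n)%N ->
  odd `|fsum n s|%N = odd (ninv (map (resid n) s)) (+)
    odd `|(((size s)%:Z - 1) * \sum_(x <- s) ceilz n x)%R|%N.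
Proof.
move=> n0; elim: s => [|x s IH]; first by rewrite /= big_nil mulr0.
have -> : fsum n (x :: s) = \sum_(y <- s) ceilz n y - (size s)%:Z * ceilz n x
    - (count (fun r => r < resid n x)%N (map (resid n) s))%:Z + fsum n s.
  rewrite /=; congr (_ + _); elim: s {IH} => [|y s IH]; first by rewrite !big_nil /= mul0r !subr0.
  rewrite !big_cons IH divz_sub_resid //= (_ : (size s).+1%:Z = (size s)%:Z + 1); last lia.
  by rewrite mulrDl mul1r; lia.
rewrite big_cons /= (_ : (size s).+1%:Z - 1 = (size s)%:Z) ?mulrDr; last lia.
move: IH; rewrite mulrBl mul1r.
move: (fsum n s) (\sum_(y <- s) _) (count _ _) (ninv _) => F A c I.
move: ((size s)%:Z * A) ((size s)%:Z * ceilz n x) => a b.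
rewrite !odd_abszD !abszN absz_nat oddD => ->.
by move: (odd _) (odd _) (odd _) (odd _) (odd _) => [] [] [] [] [].
Qed.

Lemma ninv0 s : pairwise ltn s -> ninv s = 0%N.
Proof.
elim: s => //= x s IH /andP[/allP xs /IH ->]; rewrite addn0.
by apply/eqP; rewrite -leqn0 leqNgt -has_count; apply/hasPn => y /xs /=; lia.
Qed.

Lemma fsum0 n s : pairwise (fun x y => 0 <= y - x < n%:Z) s -> fsum n s = 0.
Proof.
elim: s => //= x s IH /andP[/allP xs /IH ->]; rewrite addr0 big1_seq // => y /xs h.
by rewrite divz_small //; lia.
Qed.

Lemma segment_pairwise (T : Type) (r : rel T) (b : int -> T) (t0 : int) (k : nat) :
  (forall i j : int, t0 < i -> i < j -> j <= t0 + k%:Z -> r (b i) (b j)) ->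
  pairwise r (segment b t0 k).
Proof.
move=> h; apply/(pairwiseP (b t0)) => i j; rewrite !inE size_map size_iota => hi hj ij.
by rewrite !(nth_map 0%N) ?size_iota // !nth_iota //; apply: h; lia.
Qed.

(** Over one period the columns increase by less than [n], so [fsum] vanishes and [fsum_parity]
    turns the column inversions into [(m - 1) * ceilsum] modulo 2. The row residues increase, and
    adding [ceilsum] leaves [m * ceilsum]. *)
Lemma chi_pchain (n m : nat) (S : cellset) g (t0 : int) : (0 < n)%N ->
  pchain n S g m%:Z 1 ->
  (forall i, (1 <= (g i).1 <= n%:Z) = (t0 < i <= t0 + m%:Z)) ->
  chi n (segment g t0 m) = odd m && odd `|ceilsum n (segment g t0 m)|%N.
Proof.
move=> n0 hg ht.
have r0 : ninv (rres n (segment g t0 m)) = 0%N.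
  apply: ninv0; rewrite /rres pairwise_map; apply: segment_pairwise => i j hi ij hj /=.
  have [_ ri] := @ceilz_resid_small n (g i).1 ltac:(rewrite ht; lia).
  have [_ rj] := @ceilz_resid_small n (g j).1 ltac:(rewrite ht; lia).
  by have := incr_ltW (fun i => (g i).1) (pchain_incr1 _ _ _ _ _ hg) i j ij; lia.
have f0 : fsum n (map snd (segment g t0 m)) = 0.
  apply: fsum0; rewrite pairwise_map; apply: segment_pairwise => i j hi ij hj /=.
  have inc := incr_ltW (fun i => (g i).2) (pchain_incr2 _ _ _ _ _ hg).
  have := inc i j ij; have := inc j (i + m%:Z) ltac:(lia).
  by rewrite (pchain_per2 _ _ _ _ _ hg) mul1r; lia.
have := fsum_parity n (map snd (segment g t0 m)) n0.
rewrite f0 -cresE size_map.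
have -> : \sum_(x <- map snd (segment g t0 m)) ceilz n x = ceilsum n (segment g t0 m) + m%:Z.
  rewrite ceilsumE; set A := \sum_(x <- _) _; set A' := \sum_(x <- _) _.
  suff -> : A' = m%:Z by lia.
  rewrite /A' !big_map (eq_big_seq (fun _ => 1)); last first.
    move=> i; rewrite mem_iota => hi.
    by case: (@ceilz_resid_small n (g (t0 + i.+1%:Z)).1 ltac:(rewrite ht; lia)).
  by rewrite big_const_seq count_predT size_iota iter_addr_0 natz.
rewrite /chi r0 size_map size_iota abszM oddM.
move: (ninv _) (ceilsum _ _) => I c.
have -> : odd `|(m%:Z - 1)%R|%N = ~~ odd m by clear; lia.
have -> : odd `|(c + m%:Z)%R|%N = odd `|c|%N (+) odd m by rewrite odd_abszD.
by case: (odd I); case: (odd m); case: (odd `|c|).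
Qed.

(** [inv_tab] arranged along the recursion of AMBC, the top row against all lower ones. *)
Fixpoint itab (T : tabloid) : nat :=
  if T is p :: T' then (cross p (flatten T') + itab T')%N else 0%N.

Local Arguments rowidx : simpl never.

Lemma itab_sum (T : tabloid) : uniq (flatten T) ->
  (\sum_(i <- flatten T) \sum_(j <- flatten T) ((i < j) && (rowidx T j < rowidx T i)) = itab T)%N.
Proof.
elim: T => [|p T IH] /=; first by rewrite big_nil.
rewrite cat_uniq => /and3P[_ /hasPn np /IH <-]; rewrite big_cat /=.
have r0 i : i \in p -> rowidx (p :: T) i = 0%N by rewrite /rowidx /= => ->.
have r1 i : i \in flatten T -> rowidx (p :: T) i = (rowidx T i).+1.
  by move=> /np /= /negbTE h; rewrite /rowidx /= h.
rewrite big1_seq => [|i /r0 ip]; last by rewrite big1_seq // => j _; rewrite ip andbF.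
rewrite add0n (eq_big_seq (fun i => \sum_(j <- p) (i < j) +
   \sum_(j <- flatten T) ((i < j) && (rowidx T j < rowidx T i)))%N); last first.
  move=> i iT; rewrite big_cat /=; congr addn.
    by apply: eq_big_seq => j jp; rewrite r0 // r1 // andbT.
  by apply: eq_big_seq => j jT; rewrite !r1.
rewrite big_split /=; congr addn; rewrite exchange_big /=; apply: eq_bigr => x _.
by rewrite -sum1_count [RHS]big_mkcond; apply: eq_bigr => i _; case: (i < x)%N.
Qed.

Lemma inv_tabE n (T : tabloid) : perm_eq (flatten T) (iota 1 n) -> inv_tab n T = itab T.
Proof.
move=> p; rewrite -itab_sum; last by rewrite (perm_uniq p) iota_uniq.
rewrite (perm_big _ p) /inv_tab {1}/index_iota subn1 /=; apply: eq_bigr => i _.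
rewrite (perm_big _ p) /= (big_nat_widenl _ 1) // big_mkcond /index_iota subn1 /=.
by apply: eq_bigr => j _; case: ltnP.
Qed.

(** Removing the first part exchanges even and odd positions. Modulo 2 the change is [sumn lam], the
    number of classes of outer corners. *)
Lemma inv_part_cons l lam : (inv_part (l :: lam) + inv_part lam = sumn lam)%N.
Proof.
rewrite /inv_part big_mkcond big_ord_recl /= add0n -big_mkcond /=.
rewrite sumnE (big_nth 0%N) big_mkord [RHS](bigID (fun i : 'I__ => odd i)) /= addnC.
by congr addn.
Qed.

Lemma inv_rho_cons l lam r rho :
  inv_rho (l :: lam) (r :: rho) = (if odd l then r else 0) + inv_rho lam rho.
Proof. by rewrite /inv_rho big_mkcond big_ord_recl -big_mkcond. Qed.

Lemma chi_cat n s t : chi n (s ++ t) =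
  chi n s (+) chi n t (+) odd (cross (rres n s) (rres n t)) (+) odd (cross (cres n s) (cres n t)).
Proof.
rewrite /chi /ceilsum big_cat /= /rres /cres !map_cat !ninv_cat !oddD.
set a := \sum_(c <- s) _; set b := \sum_(c <- t) _.
have -> : odd `|(a + b)%R|%N = odd `|a|%N (+) odd `|b|%N by exact: odd_abszD.
by move: (odd _) (odd _) (odd _) (odd _) (odd _) (odd _) (odd _) (odd _) =>
  [] [] [] [] [] [] [] [].
Qed.

(** The conjuncts on residues and size strengthen the induction: they identify the outer corners
    with the lower rows of [Q] and [P], as the cross terms require. *)
Lemma AMBC_chi n B P Q rho lam : (0 < n)%N -> AMBC n B P Q rho lam ->
  forall s, reps n B s ->
  [/\ perm_eq (rres n s) (flatten Q), perm_eq (cres n s) (flatten P), sumn lam = size s &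
      chi n s = odd (itab P) (+) odd (itab Q) (+) odd (inv_part lam)
                (+) odd `|inv_rho lam rho|%N].
Proof.
move=> n0; elim=> {B P Q rho lam} [B B0|B B' S p q r l P Q rho lam _ st hpq hr _ IH] s Bs.
  have -> : s = [::].
    by case: s Bs => // x s Bs; case: (B0 x); apply: (reps_mem n _ _ _ Bs); rewrite mem_head.
  by split=> //; rewrite /chi /ceilsum big_nil /inv_part /inv_rho /= !big_ord0.
have [g [m [t0 [s' [pS hS ht [Bs' pr pc e]]]]]] := ambc_step_split n B B' S s n0 Bs st.
set sS := segment g t0 m in pr pc e.
have [prQ pcP sl e'] := IH s' Bs'.
have [_ urs ucs] := Bs.
have m0 : 0 < m%:Z.
  have := pchain_snwb _ _ _ _ _ pS 0 m%:Z; have [_ _ /(_ 0)] := pS; rewrite add0r => ->.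
  by rewrite /snwb /sh /= mul1r !ltrDl ltz_nat n0 => <-.
have sSP x : x \in sS <-> S x /\ 1 <= x.1 <= n%:Z.
  split=> [/segmentP[i hi ->]|[/hS[i ->]]]; first by rewrite ht; split; [apply/hS; exists i|].
  by rewrite ht => hi; apply/segmentP; exists i.
have cov x : S x -> exists k : int, sh n k x \in sS.
  move=> /hS[t ->]; have [k hk] := segment_cover m%:Z t t0 m0.
  exists k; apply/segmentP; exists (t + k * m%:Z) => //.
  by rewrite (pchain_sh _ _ _ _ _ _ _ pS) mulr1.
have [usS lm rE] : [/\ uniq sS, l = m & r = ceilsum n sS].
  have usS : uniq sS := pchain_segment_uniq _ _ _ _ _ t0 m pS.
  have [s2 [us2 hs2 sz2 ->]] := hr.
  have p2 : perm_eq s2 sS.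
    by apply: uniq_perm => // x; apply/idP/idP => [/hs2/sSP|/sSP/hs2].
  by split=> //; [rewrite -sz2 (perm_size p2) size_map size_iota | rewrite (perm_big _ p2)].
have [up uq hp hq] := hpq.
have urS : uniq (rres n sS).
  by move: urs; rewrite (perm_uniq pr) /rres map_cat cat_uniq => /and3P[].
have ucS : uniq (cres n sS).
  by move: ucs; rewrite (perm_uniq pc) /cres map_cat cat_uniq => /and3P[].
have pq : perm_eq (rres n sS) q.
  apply: uniq_perm => // z; apply/mapP/idP => [[x /sSP[Sx _] ->]|/hq[x [Sx <-]]].
    by apply/hq; exists x.
  by have [k hk] := cov x Sx; exists (sh n k x); rewrite ?resid_sh1.
have pp : perm_eq (cres n sS) p.
  apply: uniq_perm => // z; apply/mapP/idP => [[x /sSP[Sx _] ->]|/hp[x [Sx <-]]].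
    by apply/hp; exists x.
  by have [k hk] := cov x Sx; exists (sh n k x); rewrite ?resid_sh2.
split.
- by rewrite (perm_trans pr) // /rres map_cat /=; apply: perm_cat.
- by rewrite (perm_trans pc) // /cres map_cat /=; apply: perm_cat.
- rewrite /= sl lm -(size_map (fun x : cell => resid n x.1) s) (perm_size pr).
  by rewrite size_map size_cat size_map size_iota.
(* The number of outer corners feeds [inv_part], [chi] of the back corners feeds [inv_rho], and the
   two cross terms feed [itab Q] and [itab P]. *)
rewrite e chi_cat e' (chi_pchain n m S g t0 n0 pS ht) -/sS -rE.
rewrite (cross_perm _ _ _ _ pq prQ) (cross_perm _ _ _ _ pp pcP).
rewrite inv_rho_cons lm -sl -(inv_part_cons l lam) lm /=.
have -> : odd `|((if odd m then r else 0) + inv_rho lam rho)%R|%N =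
    (odd m && odd `|r|%N) (+) odd `|inv_rho lam rho|%N by rewrite odd_abszD; case: (odd m).
rewrite !oddD.
move: (odd _) (odd _) (odd _) (odd _) (odd _) (odd _) (odd _) (odd _) (odd _) =>
  [] [] [] [] [] [] [] [] [] //.
Qed.

(** * The length of an affine permutation *)

Section AffinePermutation.
Variables (n : nat) (f : int -> int).
Hypotheses (n0 : (0 < n)%N) (finj : injective f).
Hypothesis fper : forall i, f (i + n%:Z) = f i + n%:Z.

Definition graph_reps : seq cell := [seq (i%:Z, f i%:Z) | i <- iota 1 n].

Let fperM (i c : int) : f (i + c * n%:Z) = f i + c * n%:Z.
Proof. exact: periodM. Qed.

Lemma rres_graph : rres n graph_reps = iota 1 n.
Proof.
rewrite /rres -map_comp -[RHS]map_id; apply/eq_in_map => i; rewrite mem_iota => hi /=.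
by have [_] := @ceilz_resid_small n i%:Z ltac:(lia); lia.
Qed.

Lemma resid_f_inj (i j : nat) : (0 < i <= n)%N -> (0 < j <= n)%N ->
  resid n (f i%:Z) = resid n (f j%:Z) -> i = j.
Proof.
move=> hi hj /(resid_eq_shift n n0); rewrite -fperM => /finj.
set c := ceilz _ _ - _ => e.
have [_ +] : c + 0 = 0 /\ j%:Z = i%:Z; last lia.
by apply: (@euclid_uniq n%:Z); lia.
Qed.

Lemma graph_repsP : reps n (graph f) graph_reps.
Proof.
split.
- move=> x; rewrite /graph; split=> [e|[_ /mapP[i _ ->] [k ->]]]; last by rewrite /= fperM.
  have [ex hx] := resid_ceilzP n x.1 n0.
  exists ((resid n x.1)%:Z, f (resid n x.1)%:Z).
    by apply: map_f; rewrite mem_iota; lia.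
  exists (ceilz n x.1 - 1); rewrite (surjective_pairing x) -e /sh /= -fperM [_%:Z + _]addrC.
  by rewrite -ex.
- by rewrite rres_graph iota_uniq.
- rewrite /cres -map_comp map_inj_in_uniq ?iota_uniq // => i j; rewrite !mem_iota => hi hj.
  by apply: resid_f_inj; lia.
Qed.

Lemma cres_graph : perm_eq (cres n graph_reps) (iota 1 n).
Proof.
have [_ _ uc] := graph_repsP.
apply: uniq_perm => //; first exact: iota_uniq.
have sub : {subset cres n graph_reps <= iota 1 n}.
  move=> _ /mapP[x _ ->]; rewrite mem_iota.
  by have [_] := resid_ceilzP n x.2 n0; move: (resid _ _); lia.
by have [] := uniq_min_size uc sub; rewrite ?size_map ?size_iota.
Qed.

Let F (i j : nat) : int := ((f j%:Z - f i%:Z) %/ n%:Z)%Z.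
Let A (i j : nat) : nat := if F i j < 0 then `|F i j|%N else 0%N.
Let c (i j : nat) : nat := (A i j - (j <= i))%N.

(* The row [j + k n] lies below the row [i] iff [k >= (j <= i)], and its ball lies to the
   left of the ball of row [i] iff [k < - F i j]. *)
Let inversions (ij : nat * nat) : seq (cell * cell) :=
  [seq ((ij.1%:Z, f ij.1%:Z), sh n k%:Z (ij.2%:Z, f ij.2%:Z))
     | k <- iota (ij.2 <= ij.1)%N (c ij.1 ij.2)].

Let Fbound i j : F i j * n%:Z <= f j%:Z - f i%:Z < (F i j + 1) * n%:Z.
Proof.
have h := divz_eq (f j%:Z - f i%:Z) n%:Z; rewrite -/(F i j) in h.
have h1 : 0 <= ((f j%:Z - f i%:Z) %% n%:Z)%Z by rewrite modz_ge0 //; lia.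
have h2 : ((f j%:Z - f i%:Z) %% n%:Z)%Z < n%:Z by rewrite ltz_pmod //; lia.
rewrite mulrDl mul1r; lia.
Qed.

(** Inversions are grouped by the row [i] of the first ball and the residue [j] of the row of the
    second. *)
Lemma affine_length_sum len : affine_length n f len ->
  len = (\sum_(i <- iota 1 n) \sum_(j <- iota 1 n) c i j)%N.
Proof.
move=> [s [us hs <-]].
pose ts := [seq (i, j) | i <- iota 1 n, j <- iota 1 n].
have tsP ij : ij \in ts -> (0 < ij.1 <= n)%N /\ (0 < ij.2 <= n)%N.
  by move=> /allpairsP[[i j] [/= + + ->]]; rewrite !mem_iota /=; lia.
have -> : size s = size (flatten (map inversions ts)).
  apply/perm_size/uniq_perm => //.
    apply: (@uniq_flatten_fibers _ _ inversions
              (fun ab : cell * cell => (`|ab.1.1|%N, resid n ab.2.1))).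
    - by apply: allpairs_uniq; rewrite ?iota_uniq // => -[i j] [i' j'].
    - move=> ij; rewrite map_inj_uniq ?iota_uniq // => k k' [] + _.
      by move=> /addnI/eqP; rewrite eqn_pmul2r // => /eqP.
    - move=> [i j] ab /tsP[/= hi hj] /mapP[k _ ->]; rewrite resid_sh1 //=.
      by have [_ e] := @ceilz_resid_small n j%:Z ltac:(lia); congr pair; lia.
  move=> [[a1 a2] [b1 b2]]; apply/idP/flatten_mapP => [/hs[]|].
    rewrite /graph /sne /= => ga gb [ab1 ab2] ha.
    have [eb hb] := resid_ceilzP n b1 n0.
    exists (`|a1|%N, resid n b1).
      by apply/allpairsP; exists (`|a1|%N, resid n b1); rewrite !mem_iota /=; split=> //; lia.
    move: (resid n b1) eb hb => j eb hb.
    have [i ei] : exists i : nat, i%:Z = a1 by exists `|a1|%N; lia.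
    rewrite -ei absz_nat in ga ab1 ha *.
    have [q eq] : exists q : int, q = ceilz n b1 - 1 by eexists.
    rewrite -eq in eb.
    have e2 : b2 = f j%:Z + q * n%:Z by rewrite -fperM addrC -eb gb.
    have fb := Fbound i j.
    have q0 : 0 <= q.
      case: (lerP 0 q) => // q0.
      have : 0 <= (- q - 1) * n%:Z by apply: mulr_ge0; lia.
      by rewrite mulrBl mulNr mul1r; lia.
    have q1 : (j <= i)%N -> 1 <= q.
      case: (ltrP 0 q) => // q1; have -> : q = 0 by lia.
      by move: eb; rewrite (_ : q = 0) ?mul0r; lia.
    have qF : q < - F i j.
      case: (ltrP q (- F i j)) => // q2.
      have : 0 <= (q + F i j) * n%:Z by apply: mulr_ge0; lia.
      move: fb; rewrite !mulrDl mul1r ga; lia.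
    apply/mapP; exists `|q|%N.
      rewrite mem_iota /c /A /= ifT; last lia.
      by case: (leqP j i) q1 => hij q1; [have := q1 isT | ]; lia.
    rewrite (_ : `|q|%N%:Z = q); last lia.
    by rewrite /sh /= ga e2 eb [q * _ + _]addrC.
  move=> [[i j] /tsP[/= hi hj] /mapP[k]]; rewrite mem_iota /c /A /= => hk [-> -> -> ->].
  case: ifP hk => [Fneg|] hk; last lia.
  apply/hs; split=> /=; [by [] | by rewrite /graph /= fperM | | lia].
  have fb := Fbound i j.
  have h1 : 0 <= (- F i j - 1 - k%:Z) * n%:Z by apply: mulr_ge0; lia.
  split=> /=; last by move: h1 fb; rewrite !mulrBl mulNr mulrDl; lia.
  case: (leqP j i) hk => hij hk.
    have : 0 <= (k%:Z - 1) * n%:Z by apply: mulr_ge0; lia.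
    by rewrite mulrBl; lia.
  have : 0 <= k%:Z * n%:Z by apply: mulr_ge0; lia.
  lia.
rewrite size_flatten /shape -map_comp sumnE big_map big_allpairs.
by apply: eq_bigr => i _; apply: eq_bigr => j _; rewrite /= size_map size_iota.
Qed.

(** Distinct residues give [F i j + F j i = -1], so exactly one of the two floors is negative and
    the counts add up to the absolute value of [F i j]. *)
Lemma odd_inversions (i j : nat) : (0 < i)%N -> (i < j)%N -> (j <= n)%N ->
  odd (c i j + c j i)%N = odd `|F i j|%N.
Proof.
move=> i0 ij jn.
have ne : resid n (f i%:Z) <> resid n (f j%:Z) by move/resid_f_inj; lia.
rewrite /c /A (leqNgt j i) ij (ltnW ij) /= subn0.
have : F i j + F j i = -1.
  by rewrite /F !divz_sub_resid //; move: ne; case: ltngtP => //; lia.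
move: (F i j) (F j i) => x y; clear; case: ifP; case: ifP; lia.
Qed.

Lemma odd_length_fsum s : pairwise ltn s -> {subset s <= iota 1 n} ->
  odd (\sum_(i <- s) \sum_(j <- s) c i j)%N = odd `|fsum n [seq f i%:Z | i <- s]|%N.
Proof.
elim: s => [|x s IH]; first by rewrite big_nil.
move=> /= /andP[/allP xs /IH {}IH] sub.
have sub' : {subset s <= iota 1 n} by move=> y ys; apply: sub; rewrite inE ys orbT.
have -> : (\sum_(i <- x :: s) \sum_(j <- x :: s) c i j =
    \sum_(y <- s) (c x y + c y x) + \sum_(i <- s) \sum_(j <- s) c i j)%N.
  rewrite big_cons big_cons {1}/c /A /F subrr div0z ltxx sub0n add0n.
  under [X in (_ + X)%N]eq_bigr do rewrite big_cons.
  by rewrite !big_split /= addnA.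
rewrite oddD IH // odd_abszD; congr addb; rewrite big_map.
have hx : (0 < x)%N by move: (sub x (mem_head _ _)); rewrite mem_iota; lia.
elim: s xs sub' {IH sub} => [|y s IH] xs sub; first by rewrite !big_nil.
rewrite !big_cons oddD odd_abszD IH; last 2 first.
- by move=> z zs; apply: xs; rewrite inE zs orbT.
- by move=> z zs; apply: sub; rewrite inE zs orbT.
congr addb; apply: odd_inversions => //; first exact: xs (mem_head _ _).
by move: (sub y (mem_head _ _)); rewrite mem_iota; lia.
Qed.

(** With [a] the [ceilsum], the length is the column inversions plus [(n - 1) * (a + n)] modulo 2,
    and the sum of the [f i - i] is [n * a]; together they leave the inversions plus [a]. *)
Lemma chi_graph len : affine_length n f len ->
  odd len (+) odd `|(\sum_(1 <= i < n.+1) (f i%:Z - i%:Z))%R|%N = chi n graph_reps.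
Proof.
move=> /affine_length_sum ->; rewrite odd_length_fsum //; last first.
  by rewrite -(sorted_pairwise ltn_trans) iota_ltn_sorted.
have fE : [seq f i%:Z | i <- iota 1 n] = map snd graph_reps by rewrite -map_comp.
rewrite fE fsum_parity // -cresE size_map size_map size_iota.
have -> : \sum_(x <- map snd graph_reps) ceilz n x = ceilsum n graph_reps + n%:Z.
  rewrite ceilsumE; set X := \sum_(x <- _) _; set Y := \sum_(x <- _) _.
  suff -> : Y = n%:Z by rewrite subrK.
  rewrite /Y !big_map (eq_big_seq (fun _ => 1)); last first.
    by move=> i; rewrite mem_iota => hi; case: (@ceilz_resid_small n i%:Z ltac:(lia)).
  by rewrite big_const_seq count_predT size_iota iter_addr_0 natz.
have -> : \sum_(1 <= i < n.+1) (f i%:Z - i%:Z) = n%:Z * ceilsum n graph_reps.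
  (* The residues of the values permute [1] to [n], so only the ceilings survive in the sum. *)
  have e : \sum_(i <- iota 1 n) (resid n (f i%:Z))%:Z = \sum_(i <- iota 1 n) i%:Z.
    by rewrite -[RHS](perm_big _ cres_graph) /= !big_map.
  rewrite /ceilsum big_map mulr_sumr /index_iota subn1 /=.
  rewrite sumrB -e -sumrB; apply: eq_big_seq => i; rewrite mem_iota => hi.
  have [-> _] := @ceilz_resid_small n i%:Z ltac:(lia).
  by have [h _] := resid_ceilzP n (f i%:Z) n0; rewrite {1}h mulrC addrK.
rewrite /chi rres_graph (ninv0 (iota 1 n)); last by rewrite -(sorted_pairwise ltn_trans) iota_ltn_sorted.
rewrite !abszM !oddM !odd_abszD.
move: (ninv _) (ceilsum _ _) => I x; rewrite absz_nat /=.
by case: (odd n); case: (odd I); case: (odd `|x|).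
Qed.
End AffinePermutation.

(** * The sign formula *)

Lemma m1powE (z : int) : m1pow z = (-1) ^+ odd `|z|%N.
Proof. by rewrite /m1pow signr_odd. Qed.

Theorem theorem4p4 (n : nat) (f : int -> int) (P Q : tabloid) (rho : seq int)
    (lam : seq nat) (len : nat) :
  (0 < n)%N ->
  bijective f ->
  (forall i, f (i + n%:Z) = f i + n%:Z) ->
  AMBC n (graph f) P Q rho lam ->
  affine_length n f len ->
  (-1) ^+ len * m1pow (\sum_(1 <= i < n.+1) (f i%:Z - i%:Z))
  = m1pow ((inv_tab n P + inv_tab n Q + inv_part lam)%:Z + inv_rho lam rho).
Proof.
move=> n0 /bij_inj finj fper ambc hlen.
have [pQ pP _ e] := AMBC_chi n _ P Q rho lam n0 ambc _ (graph_repsP n f n0 finj fper).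
have cP := cres_graph n f n0 finj fper.
(* Every residue occurs exactly once in [Q] and in [P], which is what [inv_tabE] asks for. *)
rewrite rres_graph // perm_sym in pQ.
have {}pP : perm_eq (flatten P) (iota 1 n) by apply: perm_trans cP; rewrite perm_sym.
rewrite -signr_odd !m1powE -signr_addb (chi_graph n f n0 finj fper len hlen) e.
by rewrite (inv_tabE _ _ pP) (inv_tabE _ _ pQ) odd_abszD absz_nat !oddD.
Qed.
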